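(* Every graph-like continuum $X$ admits a metric compatible with its topology with respect to which $X$ is a geodesic metric space and the 1-dimensional Hausdorff measure $\mathcal{H}^1(X)$ is finite.
   Context: A continuum is a compact, connected, non-empty metrizable space. An edge of a topological space $X$ is an open subspace $I\subseteq X$ homeomorphic to $(0,1)$ whose closure in $X$ is homeomorphic to $[0,1]$. An edge-set of $X$ is a set of pairwise disjoint edges of $X$. $X$ is graph-like if it has an edge-set $E$ such that $X\setminus\bigcup E$ is totally disconnected. A metric space $(X,d)$ is geodesic if for all $x,y\in X$ there is a map $\tau:[0,l]\to X$ with $\tau(0)=x$, $\tau(l)=y$ and $d(\tau(t),\tau(t'))=|t-t'|$ for all $t,t'\in[0,l]$. $\mathcal{H}^1(X)=\lim_{\delta\to0}\inf\{\sum_i \mathrm{diam}(U_i): \bigcup_i U_i=X,\ \mathrm{diam}(U_i)<\delta\}$ (countable covers). *)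

(* Defs.v *)
From HB Require Import structures.
From mathcomp Require Import all_boot all_order all_algebra.
From mathcomp Require Import all_classical all_reals all_analysis.

Set Implicit Arguments.
Unset Strict Implicit.
Unset Printing Implicit Defensive.

Import Order.TTheory GRing.Theory Num.Theory.
Import numFieldNormedType.Exports.

Local Open Scope classical_set_scope.
Local Open Scope ring_scope.

(* A metric is a function here, not a [metricType] instance, because a space
   that already carries a topology has to be given a second, compatible
   structure. The fields are those of the factory [isMetric]. *)
Record is_metric (R : realType) (X : Type) (d : X -> X -> R) : Prop :=
  IsMetric {
    metric_refl : forall x, d x x = 0 ;
    metric_eq : forall x y, d x y = 0 -> x = y ;
    metric_comm : forall x y, d x y = d y x ;
    metric_tri : forall y x z, d x z <= d x y + d y z }.

Definition compatible (R : realType) (X : topologicalType) (d : X -> X -> R) :=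
  forall (x : X) (A : set X),
    nbhs x A <-> exists2 e : R, 0 < e & [set y | d x y < e] `<=` A.

Definition metrizable (R : realType) (X : topologicalType) :=
  exists d : X -> X -> R, is_metric d /\ compatible d.

Definition continuum (R : realType) (X : topologicalType) :=
  [/\ compact [set: X], connected [set: X], [set: X] !=set0 & metrizable R X].

(* [A] and [B] are coerced to types by [set_type], whose topology is the
   subspace topology. *)
Definition homeomorphic (X Y : topologicalType) (A : set X) (B : set Y) :=
  exists (f : A -> B) (g : B -> A),
    [/\ cancel f g, cancel g f, continuous f & continuous g].

Definition edge (R : realType) (X : topologicalType) (I : set X) :=
  [/\ open I,
      homeomorphic I (`]0, 1[%classic : set R) &
      homeomorphic (closure I) (`[0, 1]%classic : set R)].

Definition edge_set (R : realType) (X : topologicalType) (E : set (set X)) :=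
  (forall I, E I -> edge R I) /\ trivIset E id.

Definition graph_like (R : realType) (X : topologicalType) :=
  exists E : set (set X),
    edge_set R E /\ totally_disconnected (~` \bigcup_(I in E) I).

(* [tau] is total, but only its values on [0, l] are constrained; it is
   continuous there because it is an isometric embedding. *)
Definition geodesic (R : realType) (X : Type) (d : X -> X -> R) :=
  forall x y : X, exists (l : R) (tau : R -> X),
    [/\ 0 <= l, tau 0 = x, tau l = y &
        {in `[0, l] &, forall t t', d (tau t) (tau t') = `|t - t'|}].

Local Open Scope ereal_scope.

(* [maxe 0] only matters for [U = set0]: it gives the empty set diameter 0
   instead of -oo. *)
Definition diam (R : realType) (X : Type) (d : X -> X -> R) (U : set X)
    : \bar R :=
  maxe 0 (ereal_sup [set (d x y)%:E | x in U & y in U]).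

(* Finite covers are included: pad them with [set0]. *)
Definition hausdorff1_delta (R : realType) (X : Type) (d : X -> X -> R)
    (delta : R) : \bar R :=
  ereal_inf [set \sum_(i <oo) diam d (U i) | U in
    [set U : nat -> set X | \bigcup_i U i = [set: X] /\
                            forall i, diam d (U i) < delta%:E]].

Definition hausdorff1 (R : realType) (X : Type) (d : X -> X -> R) : \bar R :=
  lim (hausdorff1_delta d delta @[delta --> 0%R^'+]).

(* The limit always exists in [\bar R], so [lim] is not a default value. *)
Lemma is_cvg_hausdorff1_delta (R : realType) (X : Type) (d : X -> X -> R) :
  cvg (hausdorff1_delta d delta @[delta --> 0%R^'+]).
Proof.
apply: (@nonincreasing_at_right_is_cvge _ _ 0%R).
near=> b => x y _ _ xy; apply: ereal_inf_le_tmp => _ [U [UX Ux] <-].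
exists U => //; split=> // i; apply: lt_le_trans (Ux i) _.
by rewrite lee_fin.
Unshelve. all: by end_near. Qed.

(* Main.v *)
(* Give the edges positive lengths with a finite sum. A piece is either an arc
   inside the closure of one edge, or a closed connected set that contains or
   misses each edge; its weight is the total length of the edge parts in it. Let
   d(x, y) be the infimum of the total weights of chains of pieces from x to y.
   Every piece is a finite union of pieces of arbitrarily small weight whose
   weights add up to at most its own: for a piece of the second kind, remove
   finitely many edges carrying almost all of its length, and observe that, by
   connectedness, each clopen part of what remains contains an end of a removed
   edge, so that there are finitely many components.
   Consequently d is unchanged by restricting the chains to small pieces, which
   makes it a length metric; covers by small pieces show that d is continuous
   and bound the Hausdorff measure by the total length. Geodesics are limits of
   the step functions given by almost optimal chains, along an ultrafilter.
   Distinct points x, y have positive distance because some function f with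
   f(x) <> f(y) varies on each piece by at most a constant times its weight: a
   tent on the edge of x, or, if x and y are vertices, the interpolation along
   the edges of the indicator of a clopen set of vertices, which is constant
   outside finitely many edges. *)
Require Import Defs.
From HB Require Import structures.
From mathcomp Require Import all_boot all_order all_algebra.
From mathcomp Require Import all_classical all_reals all_analysis.
From mathcomp Require Import ring lra zify.

Set Implicit Arguments.
Unset Strict Implicit.
Unset Printing Implicit Defensive.

Import Order.TTheory GRing.Theory Num.Theory.
Import numFieldNormedType.Exports.

Local Open Scope classical_set_scope.
Local Open Scope ring_scope.

(** * The chain metric *)

(** Inside [A] the trace of [U] is closed and, as the complement of the trace of [V], also open. The
    two closed sets have to be disjoint only inside [A]. *)
Lemma connected_sub_closed (X : topologicalType) (A U V : set X) :
  connected A -> closed U -> closed V -> A `<=` U `|` V ->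
  A `&` U `&` V = set0 -> A `&` U !=set0 -> A `<=` U.
Proof.
move=> cA cU cV AUV AUV0 AU; suff <- : A `&` U = A by exact: subIsetr.
apply: cA => //; last by exists U.
exists (~` V); first exact: closed_openC.
apply/seteqP; split => x [Ax Ux]; split => //; last by case: (AUV x Ax).
by move=> Vx; rewrite -[False]/(set0 x) -AUV0.
Qed.

Section chains.
Context {R : realType} {X : Type}.
Implicit Types (P : set X -> R -> Prop) (x y z : X).

Inductive chain P : X -> X -> R -> Prop :=
| chain0 x : chain P x x 0
| chainS x z y A w L :
    P A w -> A x -> A z -> chain P z y L -> chain P x y (w + L).

Lemma chain1 P x y A w : P A w -> A x -> A y -> chain P x y w.
Proof. by move=> PA Ax Ay; rewrite -[w]addr0; apply: chainS PA Ax Ay _;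
    exact: chain0. Qed.

Lemma chain_cat P x y z L L' :
  chain P x y L -> chain P y z L' -> chain P x z (L + L').
Proof.
elim=> [{}x|{}x u {}y A w {}L PA Ax Au _ IH] yz; first by rewrite add0r.
by rewrite -addrA; apply: chainS PA Ax Au (IH yz).
Qed.

Lemma chain_sym P x y L : chain P x y L -> chain P y x L.
Proof.
elim=> [{}x|{}x z {}y A w {}L PA Ax Az _ IH]; first exact: chain0.
by rewrite addrC; apply: chain_cat IH _; exact: chain1 PA Az Ax.
Qed.

Lemma chain_ge0 P x y L :
  (forall A w, P A w -> 0 <= w) -> chain P x y L -> 0 <= L.
Proof.
by move=> P0; elim=> // *; rewrite addr_ge0 //; apply: P0; eassumption.
Qed.

(** Telescoping along the chain. A function that oscillates little on pieces thus bounds the length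
    of chains from below, which is how distinct points are kept apart. *)
Lemma chain_ge_dist P (f : X -> R) (M : R) x y L :
  (forall A w a b, P A w -> A a -> A b -> `|f a - f b| <= M * w) ->
  chain P x y L -> `|f x - f y| <= M * L.
Proof.
move=> Pf; elim=> [{}x|{}x z {}y A w {}L PA Ax Az _ IH].
  by rewrite subrr normr0 mulr0.
rewrite mulrDr -(subrK (f z) (f x)) -addrA (le_trans (ler_normD _ _)) //.
by rewrite lerD // (Pf A).
Qed.

End chains.

Section chain_in_cover.
Context {R : realType} {X : topologicalType}.

Lemma chain_of_path (Q : set X -> R -> Prop) n (F : 'I_n -> set X)
    (w : 'I_n -> R) (p : seq 'I_n) i x y :
  (forall k, Q (F k) (w k)) ->
  path [rel k l | `[< F k `&` F l !=set0 >]] i p ->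
  F i x -> F (last i p) y -> chain Q x y (\sum_(k <- i :: p) w k).
Proof.
move=> QF; elim: p i x => [|j p IH] i x /=.
  by move=> _ Fx Fy; rewrite big_seq1; exact: chain1 (QF i) Fx Fy.
move=> /andP[/asboolP[z [Fiz Fjz]] jp] Fix Fy.
by rewrite big_cons; apply: chainS (QF i) Fix Fiz (IH _ _ jp Fjz Fy).
Qed.

(* A path without repetition in the intersection graph of the cover uses each
   member at most once, so its total weight is at most that of the cover. *)
Lemma chain_of_cover (Q : set X -> R -> Prop) (A : set X) n
    (F : 'I_n -> set X) (w : 'I_n -> R) x y :
  connected A -> (forall k, closed (F k)) -> (forall k, 0 <= w k) ->
  (forall k, Q (F k) (w k)) -> A = \bigcup_k F k -> A x -> A y ->
  exists2 L, L <= \sum_k w k & chain Q x y L.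
Proof.
move=> cA cF w0 QF AF Ax Ay.
have [i _ Fix] : (\bigcup_k F k) x by rewrite -AF.
pose e := [rel k l | `[< F k `&` F l !=set0 >]].
(* The members linked to [F i] and the other members have closed unions that are disjoint, since
   intersecting members are linked. By connectedness the first union is all of [A]. *)
have /(_ y Ay) [j /= ij Fjy] : A `<=` \bigcup_(k in [set k | connect e i k]) F
    k.
  apply: (@connected_sub_closed _ _ _
    (\bigcup_(k in [set k | ~~ connect e i k]) F k)) => //.
  - by apply: closed_bigcup => //; exact: finite_finset.
  - by apply: closed_bigcup => //; exact: finite_finset.
  - move=> z; rewrite AF => -[k _ Fkz].
    by have [ik|ik] := boolP (connect e i k); [left|right]; exists k.
  - rewrite -subset0 => z [[Az [k /= ik Fkz]] [l /= /negP il Flz]]; apply: il.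
    by apply: connect_trans ik (connect1 _); apply/asboolP; exists z.
  - by exists x; split => //; exists i => //=; exact: connect0.
have /connectP[p pp jE] := ij; case/shortenP: pp jE => {}p' pp' up _ jE.
exists (\sum_(k <- i :: p') w k); last by apply: chain_of_path => //;
    rewrite -jE.
rewrite big_uniq //= big_mkcond /=; apply: ler_sum => k _.
by case: ifP.
Qed.

End chain_in_cover.

Definition fine_cover {R : realType} {X : Type} (P : set X -> R -> Prop)
    (eta : R) (A : set X) (w : R) (s : seq (set X * R)) :=
  [/\ forall p, p \in s -> P p.1 p.2 /\ p.2 < eta,
      A = \bigcup_(p in [set` s]) p.1 & \sum_(p <- s) p.2 <= w].

(** What the metric needs to know of the pieces, free of any mention of edges: [piece_split] yields
    geodesics and the measure bound, [piece_sep] yields definiteness. *)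
Record piece_system {R : realType} {X : topologicalType}
    (P : set X -> R -> Prop) : Prop := PieceSystem {
  piece_closed : forall A w, P A w -> closed A ;
  piece_connected : forall A w, P A w -> connected A ;
  piece_ge0 : forall A w, P A w -> 0 <= w ;
  piece_split : forall A w eta, P A w -> 0 < eta ->
    exists s, fine_cover P eta A w s ;
  piece_sep : forall x y, x <> y ->
    exists2 e : R, 0 < e & forall L, chain P x y L -> e <= L }.

Definition chain_dist {R : realType} {X : Type} (P : set X -> R -> Prop)
  (x y : X) : R := inf [set L | chain P x y L].

Section chain_metric.
Context {R : realType} {X : topologicalType} (P : set X -> R -> Prop) (W : R).
Hypotheses (PP : piece_system P) (PT : P [set: X] W).
Implicit Types x y z : X.

Local Notation d := (chain_dist P).

Let small eta : set X -> R -> Prop := fun A w => P A w /\ w < eta.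

Lemma chain_small A w eta x y : P A w -> 0 < eta -> A x -> A y ->
  exists2 L, L <= w & chain (small eta) x y L.
Proof.
move=> PA eta0 Ax Ay; have [s [sP As sw]] := piece_split PP PA eta0.
pose t k := tnth (in_tuple s) k.
have tP k : small eta (t k).1 (t k).2 by apply: sP; exact: mem_tnth.
have At : A = \bigcup_k (t k).1.
  rewrite As; apply/seteqP; split => z [].
    by move=> p /= ps pz; have [k kp] := tnthP (in_tuple s) p ps;
      exists k => //; rewrite /t -kp.
  by move=> k _ tz; exists (t k) => //=; exact: mem_tnth.
have [k|k|L Lw c] := @chain_of_cover _ _ (small eta) A _
    (fun k => (t k).1) (fun k => (t k).2) x y (piece_connected PP PA) _ _ tP At
    Ax Ay.
- by have [/(piece_closed PP)] := tP k.
- by have [/(piece_ge0 PP)] := tP k.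
- by exists L => //; rewrite (le_trans Lw) // -(big_tnth _ _ s xpredT snd).
Qed.

Lemma small_chain eta x y L : 0 < eta -> chain P x y L ->
  exists2 L', L' <= L & chain (small eta) x y L'.
Proof.
move=> eta0; elim=> [{}x|{}x z {}y A w {}L PA Ax Az _ [L2 L2L c2]].
  by exists 0 => //; exact: chain0.
have [L1 L1w c1] := chain_small PA eta0 Ax Az.
by exists (L1 + L2); [exact: lerD|exact: chain_cat c1 c2].
Qed.

Lemma chain_dist_le x y L : chain P x y L -> d x y <= L.
Proof.
move=> c; apply: ge_inf => //.
by exists 0 => L'; apply: chain_ge0; exact: (piece_ge0 PP).
Qed.

Lemma piece_dist A w x y : P A w -> A x -> A y -> d x y <= w.
Proof. by move=> PA Ax Ay; apply: chain_dist_le; exact: chain1 PA Ax Ay. Qed.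

(** Since the whole space is a piece, any two points are joined by a chain, so the infimum is never
    the default value on the empty set. *)
Lemma le_chain_dist x y e : (forall L, chain P x y L -> e <= L) -> e <= d x y.
Proof. by move=> le; apply: lb_le_inf le; exists W; exact: chain1 PT _ _. Qed.

Lemma chain_dist_ge0 x y : 0 <= d x y.
Proof.
by apply: le_chain_dist => L; apply: chain_ge0; exact: (piece_ge0 PP).
Qed.

Lemma chain_dist_adherent eta x y : 0 < eta ->
  exists2 L, L < d x y + eta & chain (small eta) x y L.
Proof.
move=> eta0.
have [|L c Ld] := @inf_adherent _ [set L | chain P x y L] eta eta0.
  split; first by exists W; exact: chain1 PT _ _.
  by exists 0 => L'; apply: chain_ge0; exact: (piece_ge0 PP).
have [L' L'L c'] := small_chain eta0 c.
by exists L' => //; exact: le_lt_trans Ld.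
Qed.

Lemma is_metric_chain_dist : is_metric d.
Proof.
have d_le x y : d x y <= d y x.
  apply: le_chain_dist => L c; apply: chain_dist_le; exact: chain_sym.
split.
- move=> x; apply/eqP; rewrite eq_le chain_dist_ge0 andbT.
  by apply: chain_dist_le; exact: chain0.
- move=> x y dxy; apply: contrapT => xy.
  have [e e0 /(@le_chain_dist x y e)] := piece_sep PP xy.
  by rewrite dxy leNgt e0.
- by move=> x y; apply/eqP; rewrite eq_le !d_le.
- move=> y x z; rewrite -lerBlDr; apply: le_chain_dist => L c.
  rewrite lerBlDr -lerBlDl; apply: le_chain_dist => L' c'.
  by rewrite lerBlDl; apply: chain_dist_le; exact: chain_cat c c'.
Qed.

(* Cover the space by pieces of weight below [e]: the complement of those that
   miss [x] is a neighborhood of [x], and the others contain [x]. *)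
Lemma nbhs_chain_ball x e : 0 < e -> nbhs x [set y | d x y < e].
Proof.
move=> e0; have [s [sP sT _]] := piece_split PP PT e0.
pose far := \bigcup_(p in [set p | p \in s /\ ~ p.1 x]) p.1.
have cfar : closed far.
  apply: closed_bigcup => [|p [/sP[/(piece_closed PP)]]//].
  by apply: (@sub_finite_set _ _ [set` s]) => // p [].
apply: (@filterS _ _ _ (~` far)).
  move=> y nfar; have [p /= ps py] : (\bigcup_(p in [set` s]) p.1) y.
    by rewrite -sT.
  have [Pp pe] := sP p ps; rewrite /= (le_lt_trans _ pe) //.
  apply: (piece_dist Pp) => //; apply: contrapT => px.
  by apply: nfar; exists p.
by apply: open_nbhs_nbhs; split; [exact: closed_openC|case=> p []].
Qed.

(** Balls are neighborhoods. Conversely, the distance from [x] is positive and continuous on the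
    compact complement of the interior of [A], so one radius works for all of that complement. *)
Lemma compatible_chain_dist : compact [set: X] -> compatible d.
Proof.
move=> cX x A; split=> [xA|[e e0 eA]]; last first.
  by apply: filterS eA _; exact: nbhs_chain_ball.
have [m_refl m_eq m_comm m_tri] := is_metric_chain_dist.
have cA : compact (~` A°).
  by apply: subclosed_compact cX _ => //; exact/open_closedC/open_interior.
have /compact_near_coveringP/(_ _ (0%R : R)^'+ (fun e y => e <= d x y)) := cA.
move=> /(_ _) He; have /filter_ex[e [e0 eA]] : \forall e \near (0 : R)^'+,
    0 < e /\ ~` A° `<=` (fun y => e <= d x y).
  near=> e; split; first by near: e; exact: nbhs_right_gt.
  near: e; apply: He => y yA.
  have dxy : 0 < d x y.
    rewrite lt_neqAle chain_dist_ge0 andbT; apply/eqP => dxy.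
    by apply: yA; rewrite -(m_eq x y).
  exists ([set z | d y z < d x y / 2], [set e | e < d x y / 2]).
    split => /=; first by apply: nbhs_chain_ball; rewrite divr_gt0.
    by apply: nbhs_right_lt; rewrite divr_gt0.
  move=> [z e] /= [yz ez].
  by have := m_tri z x y; rewrite (m_comm z y); lra.
exists e => // y /= dxy; apply: interior_subset; apply: contrapT => /eA /=.
by rewrite leNgt dxy.
Unshelve. all: by end_near. Qed.

End chain_metric.

(** * Geodesics and Hausdorff measure of the chain metric *)

Lemma fmap_ultra (T U : Type) (f : T -> U) (F : set_system T) :
  UltraFilter F -> UltraFilter (f @ F).
Proof.
move=> FU; split=> [|G GF FG]; first exact: fmap_proper_filter.
apply/seteqP; split=> [A GA|]; last exact: FG.
have [//|FnA] := in_ultra_setVsetC (f @^-1` A) FU.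
have /filter_ex[? []//] : G (A `&` ~` A) by apply: filterI => //; exact: FG.
Qed.

Section chain_geodesic.
Context {R : realType} {X : topologicalType} (P : set X -> R -> Prop) (W : R).
Hypotheses (PP : piece_system P) (PT : P [set: X] W).

Local Notation d := (chain_dist P).

Let dM : is_metric d := is_metric_chain_dist PP PT.

Let d_ge0 x y : 0 <= d x y. Proof. exact: chain_dist_ge0 PP PT x y. Qed.

(** The map waits at each point of the chain for the weight of the next link, then jumps. Being
    late, it is never farther than [t] from [x]; between two times it gains at most one link, of
    weight below [eta]. *)
Lemma chain_param eta x y L : 0 < eta ->
  chain (fun A w => P A w /\ w < eta) x y L ->
  exists tau : R -> X, [/\ tau 0 = x, tau L = y,
    forall t, 0 <= t -> d x (tau t) <= t &
    forall s t, 0 <= s -> s <= t -> d (tau s) (tau t) <= t - s + eta].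
Proof.
move=> eta0; elim=> [{}x|{}x z {}y A w {}L [PA weta] Ax Az c].
  exists (fun=> x); split=> // [t t0|s t s0 st]; rewrite (metric_refl dM) //.
  by rewrite addr_ge0 ?subr_ge0 // ltW.
move=> [tau [tau0 tauL dtau dtau2]].
have w0 := piece_ge0 PP PA; have xz := piece_dist PP PA Ax Az.
have L0 : 0 <= L by apply: chain_ge0 c => B v [/(piece_ge0 PP)].
pose sigma t := if t < w then x else tau (t - w).
have dsigma t : 0 <= t -> d x (sigma t) <= t.
  rewrite /sigma => t0; case: ltP => tw; first by rewrite (metric_refl dM).
  rewrite (le_trans (metric_tri dM z _ _)) // -[leRHS](subrKC w) lerD // dtau
      //.
  by rewrite subr_ge0.
exists sigma; split => //.
(* A link of weight 0 is passed without waiting, but its two points are at distance 0 and hence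
   equal. *)
- rewrite /sigma; case: ltP => // wle0; rewrite sub0r.
  have -> : w = 0 by apply/eqP; rewrite eq_le wle0.
  rewrite oppr0 tau0; apply/esym/(metric_eq dM)/eqP.
  by rewrite eq_le d_ge0 // (le_trans xz).
- by rewrite /sigma ltNge lerDl L0 /= addrAC subrr add0r.
- move=> s t s0 st; have [sw|ws] := ltP s w.
    rewrite {1}/sigma sw (le_trans (dsigma t _)) ?(le_trans s0) //.
    by move: sw weta; lra.
  rewrite /sigma !ltNge ws (le_trans ws st) /=.
  rewrite (le_trans (dtau2 _ _ _ _)) ?subr_ge0 ?lerD2r //.
  by move: st; lra.
Qed.

(** The upper bound is that of [chain_param]. For the lower one, subtract from [d x y] the cost of
    going from [x] to [tau s] and from [tau t] to [y]: the chain is too short for [tau] to lose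
    more. *)
Lemma near_geodesic x y eta : 0 < eta -> exists tau : R -> X,
  [/\ tau 0 = x, d (tau (d x y)) y <= eta + eta &
   forall s t, 0 <= s -> s <= t -> t <= d x y ->
    `|d (tau s) (tau t) - (t - s)| <= eta + eta].
Proof.
move=> eta0; have [L Ld c] := chain_dist_adherent PP PT x y eta0.
have dL : d x y <= L.
  apply: chain_dist_le => //; elim: c => [?|? ? ? ? ? ? [PA _] Ax Az _ IH].
    exact: chain0.
  exact: chainS PA Ax Az IH.
have d0 := d_ge0 x y.
have [tau [tau0 tauL dtau dtau2]] := chain_param eta0 c.
exists tau; split => // [|s t s0 st td].
  by rewrite -[X in d _ X]tauL (le_trans (dtau2 _ _ _ dL)) //; move: Ld; lra.
have t0 := le_trans s0 st.
have := dtau2 t L t0 (le_trans td dL); rewrite tauL => dty.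
have := dtau s s0; have := dtau2 s t s0 st.
have := metric_tri dM (tau t) x y; have := metric_tri dM (tau s) x (tau t).
by rewrite ler_norml; lra.
Qed.

Lemma geodesic_chain_dist : compact [set: X] -> geodesic d.
Proof.
move=> cX x y; have d0 := d_ge0 x y.
have /choice[tau tauP] : forall n : nat, exists tau : R -> X,
  [/\ tau 0 = x, d (tau (d x y)) y <= n.+1%:R^-1 + n.+1%:R^-1 &
   forall s t, 0 <= s -> s <= t -> t <= d x y ->
    `|d (tau s) (tau t) - (t - s)| <= n.+1%:R^-1 + n.+1%:R^-1].
  by move=> n; apply: near_geodesic; rewrite invr_gt0 ltr0n.
(* Along one ultrafilter finer than [\oo], compactness makes [tau n t] converge for all real [t] at
   once. *)
have [G [GU ooG]] := @ultraFilterLemma nat \oo _.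
have GI A B : G A -> G B -> G (A `&` B) by exact: filterI.
have /choice[sigma sigmaP] : forall t, exists p : X, tau n t @[n --> G] --> p.
  move=> t; have := cX; rewrite compact_ultra => /(_ (tau n t @[n --> G])).
  have := fmap_ultra (tau ^~ t) GU.
  by move=> GtU /(_ GtU)[|p [_ ?]]; [exact: filterT|exists p].
have small (e : R) : 0 < e -> G (fun n => n.+1%:R^-1 < e).
  by move=> e0; have /ooG := near_infty_natSinv_lt (PosNum e0).
have close t e : 0 < e -> G (fun n => d (sigma t) (tau n t) < e).
  by move=> e0; exact: (sigmaP t _ (nbhs_chain_ball PP PT (sigma t) e0)).
have dist0 u v : (forall e, 0 < e -> d u v <= e) -> u = v.
  move=> uv; apply: (metric_eq dM); apply/eqP; rewrite eq_le d_ge0 //.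
  by rewrite andbT; apply/ler_addgt0Pr => e e0; rewrite add0r uv.
have mono s t : 0 <= s -> s <= t -> t <= d x y ->
    d (sigma s) (sigma t) = t - s.
  move=> s0 st td; apply/eqP; rewrite -subr_eq0 -normr_eq0 eq_le normr_ge0
      andbT.
  apply/ler_addgt0Pr => e e0; rewrite add0r.
  (* Four errors add up: the two limits, and twice the tolerance of [tau n]. *)
  have e4 : 0 < e / 4 by rewrite divr_gt0.
  have /filter_ex[n [[cs ct] ne]] :=
    GI _ _ (GI _ _ (close s _ e4) (close t _ e4)) (small _ e4).
  have [_ _ /(_ s t s0 st td)] := tauP n; rewrite !ler_norml.
  have := metric_tri dM (tau n s) (sigma s) (sigma t).
  have := metric_tri dM (tau n t) (tau n s) (sigma t).
  have := metric_tri dM (sigma s) (tau n s) (tau n t).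
  have := metric_tri dM (sigma t) (sigma s) (tau n t).
  rewrite (metric_comm dM (tau n t) (sigma t)) (metric_comm dM (tau n s) (sigma
      s)).
  by move: ne; set u := n.+1%:R^-1; lra.
exists (d x y), sigma; split => //.
- apply: dist0 => e e0; have /filter_ex[n] := close 0 _ e0.
  by have [-> _ _] := tauP n => /ltW.
- apply: dist0 => e e0; have e4 : 0 < e / 4 by rewrite divr_gt0.
  have /filter_ex[n [cs ne]] := GI _ _ (close (d x y) _ e4) (small _ e4).
  have [_ + _] := tauP n.
  have := metric_tri dM (tau n (d x y)) (sigma (d x y)) y.
  by move: ne; set u := n.+1%:R^-1; lra.
- move=> s t; rewrite !in_itv /= => /andP[s0 sd] /andP[t0 td].
  have [st|/ltW ts] := leP s t; first by rewrite distrC ger0_norm ?subr_ge0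
      ?mono.
  by rewrite (metric_comm dM) mono // ger0_norm ?subr_ge0.
Qed.

Lemma hausdorff1_chain_dist : (hausdorff1 d < +oo)%E.
Proof.
apply: (@le_lt_trans _ _ W%:E); last exact: ltry.
apply: lime_le; first exact: is_cvg_hausdorff1_delta.
near=> e; have e0 : 0 < e by near: e; exact: nbhs_right_gt.
have [s [sP sT sW]] := piece_split PP PT e0.
have diam_le A w : P A w -> (diam d A <= w%:E)%E.
  move=> PA; rewrite /diam ge_max lee_fin (piece_ge0 PP PA) /=.
  apply: ge_ereal_sup => _ [a Aa [b Ab <-]]; rewrite lee_fin.
  exact: (@piece_dist _ _ _ PP A w).
have diam0 : diam d set0 = 0%E.
  rewrite /diam (_ : [set _ | _ in _ & _ in _] = set0) ?ereal_sup0.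
    by apply/max_idPl; exact: leNye.
  by rewrite -subset0 => ? [? []].
(* Beyond the finite cover by small pieces the sequence is [set0], of diameter 0; elsewhere the
   diameter is at most the weight, so the sum stays below [W] at every scale. *)
pose U i := (nth (set0, 0) s i).1.
apply: ge_ereal_inf; exists (\sum_(i <oo) diam d (U i))%E.
  exists U => //; split.
    rewrite sT; apply/seteqP; split => x [].
      move=> i _ Uix; have si : (i < size s)%N.
        by rewrite ltnNge; apply/negP => si; move: Uix; rewrite /U nth_default.
      by exists (nth (set0, 0) s i) => //=; exact: mem_nth.
    move=> p /= ps px; exists (index p s) => //.
    by rewrite /U nth_index.
  move=> i; rewrite /U; have [si|si] := ltnP i (size s).
    have [Pp pe] := sP _ (mem_nth (set0, 0) si).
    by rewrite (le_lt_trans (diam_le _ _ Pp)) // lte_fin.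
  by rewrite nth_default // diam0 lte_fin.
have dge0 A : (0 <= diam d A)%E by rewrite /diam le_max lexx.
rewrite (nneseries_split _ (size s)) // add0n eseries0 ?adde0; last first.
  by move=> i si _; rewrite /U nth_default.
rewrite (le_trans _ (_ : (\sum_(p <- s) p.2)%:E <= _)%E) ?lee_fin //.
rewrite -sumEFin (big_nth (set0, 0)) [leLHS]big_nat [leRHS]big_nat.
apply: lee_sum => i /andP[_ si]; apply: diam_le.
by have [] := sP _ (mem_nth (set0, 0) si).
Unshelve. all: by end_near. Qed.

End chain_geodesic.

(** * Splitting the pieces of a graph-like continuum *)

Section summable_weight.
Context {R : realType} {T : choiceType} (E : set T) (l : T -> R).
Hypotheses (l0 : forall e, E e -> 0 < l e)
  (lsum : (\esum_(e in E) (l e)%:E < +oo)%E).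
Implicit Types D : set T.

(** The sum is bounded by the finite total, so [fine] loses nothing. *)
Definition weight D : R := fine (\esum_(e in E `&` D) (l e)%:E).

Let esum_l_ge0 D : (0 <= \esum_(e in E `&` D) (l e)%:E)%E.
Proof. by apply: esum_ge0 => e [/l0 /ltW]; rewrite lee_fin. Qed.

Let esum_lID D D' : \esum_(e in E `&` D) (l e)%:E =
  (\esum_(e in E `&` (D `&` D')) (l e)%:E +
   \esum_(e in E `&` (D `&` ~` D')) (l e)%:E)%E.
Proof.
by rewrite (esumID D') ?setIA // => e [/l0 /ltW]; rewrite lee_fin.
Qed.

Let weightE D : (weight D)%:E = \esum_(e in E `&` D) (l e)%:E.
Proof.
rewrite fineK // ge0_fin_numE //; apply: le_lt_trans lsum.
rewrite -[E in leRHS](setIT E) (esum_lID setT D) setTI leeDl //.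
Qed.

Lemma weight_ge0 D : 0 <= weight D.
Proof. by rewrite -lee_fin weightE. Qed.

Lemma weightID D' D : weight D = weight (D `&` D') + weight (D `&` ~` D').
Proof. by apply: EFin_inj; rewrite EFinD !weightE -esum_lID. Qed.

Lemma le_weight D D' : E `&` D `<=` D' -> weight D <= weight D'.
Proof.
move=> DD'; rewrite (weightID D D').
suff -> : weight D = weight (D' `&` D) by rewrite lerDl weight_ge0.
congr (fine (esum _ _)); apply/seteqP; split => e [Ee].
  by move=> De; split => //; split => //; exact: DD'.
by move=> [].
Qed.

Lemma weight1 e : E e -> weight [set e] = l e.
Proof.
move=> Ee; apply: EFin_inj; rewrite weightE.
rewrite (_ : E `&` _ = [set e]) ?esum_set1 ?lee_fin ?ltW ?l0 //.
by apply/seteqP; split => [? []|? ->].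
Qed.

Lemma weight_disj D D' D'' : E `&` D `<=` D'' -> E `&` D' `<=` D'' ->
  E `&` D `&` D' = set0 -> weight D + weight D' <= weight D''.
Proof.
move=> DD DD' D0; rewrite (weightID D D''); apply: lerD; apply: le_weight.
  by move=> e [Ee De]; split => //; exact: DD.
move=> e [Ee De]; split; first exact: DD'.
by move=> De'; rewrite -[False]/(set0 e) -D0.
Qed.

Lemma weight_seq (F : seq T) : uniq F -> (forall e, e \in F -> E e) ->
  \sum_(e <- F) l e = weight [set` F].
Proof.
elim: F => [|e F IH] /=.
  rewrite big_nil => _ _; rewrite /weight esum1 // => e [_]/=.
  by rewrite in_nil.
move=> /andP[eF uF] FE; rewrite big_cons IH //; last first.
  by move=> f fF; apply: FE; rewrite inE fF orbT.
rewrite (weightID [set e] [set` e :: F]) -(weight1 (FE _ (mem_head _ _))).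
congr (_ + _); congr (fine (esum _ _)); apply/seteqP; split => f /=.
- by move=> [Ef fe]; split=> //; split=> //; rewrite fe mem_head.
- by move=> [Ef [_ fe]].
- move=> [Ef fF]; split => //; rewrite inE fF orbT; split => // fe.
  by move: eF; rewrite -fe fF.
- by move=> [Ef [+ fe]]; rewrite inE => /orP[/eqP|].
Qed.

(** The total is the supremum of its finite partial sums; a partial sum within [eta] of it leaves a
    tail below [eta]. *)
Lemma weight_tail eta : 0 < eta -> exists F : seq T,
  [/\ uniq F, forall e, e \in F -> E e & weight (~` [set` F]) < eta].
Proof.
move=> eta0; have wT := weightE setT; rewrite setIT in wT.
have wE : \esum_(e in E) (l e)%:E \is a fin_num by rewrite -wT.
have [_ [A [/finite_seqP[s ->] sE] <-]] := ub_ereal_sup_adherent eta0 wE.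
rewrite -esum_fset //; last by move=> e; rewrite inE => /sE/l0/ltW;
    rewrite lee_fin.
move=> lt; exists (undup s); split => [|e|]; first exact: undup_uniq.
  by rewrite mem_undup => /sE.
rewrite (_ : [set` undup s] = [set` s]); last first.
  by apply/seteqP; split => e /=; rewrite mem_undup.
move: lt; rewrite -[ereal_sup _]/(\esum_(e in E) (l e)%:E).
rewrite -wT [in X in (_ < X)%E](_ : [set` s] = E `&` [set` s]); last first.
  by apply/seteqP; split => [e es|e []//]; split => //; exact: sE.
rewrite -weightE -EFinB lte_fin (weightID [set` s] setT) !setTI.
by lra.
Qed.

End summable_weight.

(** Each [g e] is an embedding of the closed interval, but only its interior is tied to [e]. That
    the two ends are vertices is derived in [end_in_vertices]. *)
Record graph_structure {R : realType} {X : topologicalType}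
    (E : set (set X)) (g : set X -> R -> X) (l : set X -> R) : Prop :=
  GraphStructure {
    gs_hausdorff : hausdorff_space X ;
    gs_compact : compact [set: X] ;
    gs_connected : connected [set: X] ;
    gs_open : forall e, E e -> open e ;
    gs_cont : forall e, E e -> {within `[0, 1], continuous (g e)} ;
    gs_inj : forall e, E e -> {in `[0, 1] &, injective (g e)} ;
    gs_im : forall e, E e -> g e @` `]0, 1[ = e ;
    gs_triv : trivIset E id ;
    gs_vertices : totally_disconnected (~` \bigcup_(e in E) e) ;
    gs_gt0 : forall e, E e -> 0 < l e ;
    gs_summable : (\esum_(e in E) (l e)%:E < +oo)%E }.

Section graph_pieces.
Context {R : realType} {X : topologicalType}.
Context {E : set (set X)} {g : set X -> R -> X} {l : set X -> R}.
Hypothesis gsE : graph_structure E g l.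
Implicit Types (e K A B : set X) (s t : R).

Local Notation V := (~` \bigcup_(e in E) e).

Definition segment e s t : set X := g e @` `[s, t].

Lemma segment_within e s t : E e -> 0 <= s -> t <= 1 ->
  {within `[s, t], continuous (g e)}.
Proof.
move=> Ee s0 t1; apply: continuous_subspaceW (gs_cont gsE Ee).
by move=> u /=; rewrite !in_itv /= => /andP[su ut];
  rewrite (le_trans s0) // (le_trans ut).
Qed.

Lemma closed_segment e s t : E e -> 0 <= s -> t <= 1 -> closed (segment e s t).
Proof.
move=> Ee s0 t1; apply: compact_closed; first exact: gs_hausdorff gsE.
by apply: continuous_compact; [exact: segment_within|exact: segment_compact].
Qed.

Lemma connected_segment e s t : E e -> 0 <= s -> t <= 1 ->
  connected (segment e s t).
Proof.
move=> Ee s0 t1; apply: connected_continuous_connected.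
  exact: segment_connected.
exact: segment_within.
Qed.

Lemma segmentP e t : E e -> 0 <= t <= 1 ->
  [\/ t = 0, t = 1 | e (g e t)].
Proof.
move=> Ee /andP[]; rewrite le_eqVlt => /predU1P[<- _|t0]; first exact: Or31.
rewrite le_eqVlt => /predU1P[->|t1]; first exact: Or32.
apply: Or33; rewrite -[X in X (g e t)](gs_im gsE Ee); exists t => //.
by rewrite /= in_itv /= t0.
Qed.

Lemma edge_sub_segment e : E e -> e `<=` segment e 0 1.
Proof.
move=> Ee x; rewrite -{1}(gs_im gsE Ee) => -[t t01 <-]; exists t => //.
exact: subset_itv_oo_cc t01.
Qed.

Lemma connected_edge e : E e -> connected e.
Proof.
move=> Ee; rewrite -(gs_im gsE Ee); apply: connected_continuous_connected.
  exact/connected_intervalP/interval_is_interval.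
apply: continuous_subspaceW (gs_cont gsE Ee).
exact: subset_itv_oo_cc.
Qed.

Lemma edge_nonempty e : E e -> e !=set0.
Proof.
move=> Ee; exists (g e 2^-1); rewrite -[X in X (g e _)](gs_im gsE Ee).
by exists 2^-1 => //=; rewrite in_itv /=; apply/andP; split; lra.
Qed.

Lemma edge_uniq e e' x : E e -> E e' -> e x -> e' x -> e = e'.
Proof. by move=> Ee Ee' ex e'x; apply: (gs_triv gsE) => //; exists x. Qed.

(* A neighborhood of an end missing the edge would make a set of at most two
   points clopen in the connected arc. *)
Lemma segment_sub_closure e : E e -> segment e 0 1 `<=` closure e.
Proof.
move=> Ee x Sx; apply: contrapT => nclx.
have T1 := iffLR accessible_finite_set_closed (hausdorff_accessible
    (gs_hausdorff gsE)).
have SE : segment e 0 1 `&` ~` closure e = segment e 0 1.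
  apply: (connected_segment Ee (lexx 0) (lexx 1)).
  - by exists x.
  - by exists (~` closure e) => //; exact/closed_openC/closed_closure.
  - exists (segment e 0 1 `&` ~` closure e); last by rewrite setIA setIid.
    apply: T1; apply: (@sub_finite_set _ _ [set g e 0; g e 1]) => // y [].
    move=> [t /= +  <-] ncl; rewrite in_itv /= => /(segmentP Ee)[->|->|et].
    + by left.
    + by right.
    + by exfalso; apply: ncl; exact: subset_closure.
have [y ey] := edge_nonempty Ee.
have := edge_sub_segment Ee ey; rewrite -SE => -[_]; apply.
exact: subset_closure.
Qed.

(** An end is in the closure of [e], so an open edge containing it meets [e] and is [e] itself. The
    end would then also have an interior parameter, against injectivity. *)
Lemma end_in_vertices e t : E e -> t = 0 \/ t = 1 -> V (g e t).
Proof.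
move=> Ee t01 [e' Ee' e't].
have tI : t \in `[0, 1] by case: t01 => ->; rewrite in_itv /= ?lexx ?ler01.
have /segment_sub_closure : segment e 0 1 (g e t) by exists t.
move=> /(_ Ee e' (open_nbhs_nbhs (conj (gs_open gsE Ee') e't)))[z [ez e'z]].
move: e't; rewrite -(edge_uniq Ee Ee' ez e'z) -{1}(gs_im gsE Ee) => -[s /= s01
    gst].
have st : s = t by apply: (gs_inj gsE Ee) => //; exact: subset_itv_oo_cc s01.
by move: s01; rewrite st; case: t01 => ->; rewrite in_itv /= ltxx ?andbF.
Qed.

Definition saturated A := forall e, E e -> e `<=` A \/ e `&` A = set0.

Definition edges_of A : set (set X) := [set e | e `<=` A].

(** A saturated set weighs at least as much as any edge in it, so cutting finely inside an edge
    takes the second kind of piece. *)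
Variant piece : set X -> R -> Prop :=
| piece_sat A : closed A -> connected A -> saturated A ->
    piece A (weight E l (edges_of A))
| piece_seg e s t : E e -> 0 <= s -> s <= t -> t <= 1 ->
    piece (segment e s t) (l e * (t - s)).

Let l0 := gs_gt0 gsE.
Let lsum := gs_summable gsE.

Lemma fine_cover_cat eta A B v w (s t : seq (set X * R)) :
  fine_cover piece eta A v s -> fine_cover piece eta B w t ->
  fine_cover piece eta (A `|` B) (v + w) (s ++ t).
Proof.
move=> [sP -> sv] [tP -> tw]; split.
- by move=> p; rewrite mem_cat => /orP[/sP|/tP].
- apply/seteqP; split => x.
    by move=> [[p /= ps px]|[p /= pt px]]; exists p => //=;
      rewrite mem_cat ?ps ?pt ?orbT.
  move=> [p /=]; rewrite mem_cat => /orP[ps|pt] px; first by left; exists p.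
  by right; exists p.
- by rewrite big_cat lerD.
Qed.

Lemma fine_cover1 eta A w :
  piece A w -> w < eta -> fine_cover piece eta A w [:: (A, w)].
Proof.
move=> PA weta; split => [p|| ]; last by rewrite big_seq1.
  by rewrite inE => /eqP ->.
apply/seteqP; split => [x Ax|x [p /=]]; first by exists (A, w) => //=;
    rewrite inE.
by rewrite inE => /eqP ->.
Qed.

Lemma fine_cover_le eta A v w c :
  v <= w -> fine_cover piece eta A v c -> fine_cover piece eta A w c.
Proof. by move=> vw [? ? cv]; split => //; exact: le_trans vw. Qed.

(** Repeated halving. Since [n < 2 ^ n], any integer above the ratio of the weight to [eta] is
    enough halvings. *)
Lemma split_segment eta e s t : 0 < eta -> E e -> 0 <= s -> s <= t -> t <= 1 ->
  exists c, fine_cover piece eta (segment e s t) (l e * (t - s)) c.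
Proof.
move=> eta0 Ee; have [n] : exists n, l e * (t - s) < eta * 2 ^+ n.
  exists (Num.bound `|l e * (t - s) / eta|).
  rewrite [eta * _]mulrC -ltr_pdivrMr //.
  rewrite (le_lt_trans (ler_norm _)) // (lt_le_trans (archi_boundP _)) //.
  by rewrite -natrX ler_nat ltnW // ltn_expl.
elim: n s t => [|n IH] s t lt s0 st t1.
  by eexists; apply: fine_cover1; [exact: piece_seg|rewrite -[eta]mulr1].
have le0 := l0 Ee; pose m := (s + t) / 2.
have [sm mt] : s <= m /\ m <= t by rewrite /m; split; lra.
have half : l e * (m - s) < eta * 2 ^+ n /\ l e * (t - m) < eta * 2 ^+ n.
  have -> : m - s = (t - s) / 2 by rewrite /m; lra.
  have -> : t - m = (t - s) / 2 by rewrite /m; lra.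
  by rewrite mulrA ltr_pdivrMr // -mulrA -exprSr.
have [c1 c1P] := IH s m half.1 s0 sm (le_trans mt t1).
have [c2 c2P] := IH m t half.2 (le_trans s0 sm) mt t1.
exists (c1 ++ c2).
have -> : segment e s t = segment e s m `|` segment e m t.
  rewrite -image_setU; congr (_ @` _); apply/seteqP; split => u /=;
    rewrite !in_itv /=.
    by move=> /andP[-> ->]; rewrite andbT; apply/orP; exact: le_total.
  move=> [/andP[-> um]|/andP[mu ->]]; first by rewrite (le_trans um).
  by rewrite (le_trans sm).
by rewrite -(subrKA m t) [X in l e * X]addrC mulrDr; exact: fine_cover_cat.
Qed.

Lemma segmentE e x : E e -> segment e 0 1 x -> [\/ e x, x = g e 0 | x = g e 1].
Proof.
move=> Ee [t /=]; rewrite in_itv /= => /(segmentP Ee)[->|->|et] <-.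
- exact: Or32.
- exact: Or33.
- exact: Or31.
Qed.

Section split_saturated.
Variables (K : set X) (eta : R) (F : seq (set X)).
Hypotheses (cK : closed K) (conK : connected K) (satK : saturated K).
Hypotheses (FE : forall e, e \in F -> E e) (FK : forall e, e \in F -> e `<=` K).
Hypothesis uF : uniq F.
Hypothesis etaF : weight E l (edges_of K `&` ~` [set` F]) < eta.

Let Y := K `\` \bigcup_(e in [set` F]) e.

Let ends := [seq g e 0 | e <- F] ++ [seq g e 1 | e <- F].

(* If [B] contained no end of a removed edge, it would be clopen in [K]. *)
Lemma clopen_contains_end B : closed B -> closed (Y `\` B) -> B `<=` Y ->
  B !=set0 -> ~ K `<=` B -> has (mem B) ends.
Proof.
move=> cB cYB BY B0 KB; apply: contrapT => /negP/hasPn nends; apply: KB.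
pose S := \bigcup_(e in [set` F]) segment e 0 1.
have BK : B `<=` K by move=> x /BY[].
apply: (@connected_sub_closed _ _ _ ((Y `\` B) `|` S)) => //.
- apply: closedU => //; apply: closed_bigcup => [|e /= eF].
    exact: finite_seq.
  by apply: closed_segment; rewrite ?lexx //; exact: FE.
- move=> x Kx; have [[e /= eF ex]|nx] := pselect ((\bigcup_(e in [set` F]) e)
    x).
    by right; right; exists e => //; apply: edge_sub_segment ex; exact: FE.
  by have [Bx|nBx] := pselect (B x); [left|right; left].
- rewrite -subset0 => x [[_ Bx]] [[_ //]|[e /= eF /(segmentE (FE
    eF))[ex|xe|xe]]].
  + by have [_] := BY x Bx; apply; exists e.
  + have /nends : x \in ends by rewrite mem_cat xe map_f.
    by rewrite /= mem_set.
  + have /nends : x \in ends by rewrite mem_cat xe [X in _ || X]map_f ?orbT.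
    by rewrite /= mem_set.
- by case: B0 => x Bx; exists x; split => //; exact: BK.
Qed.

(** Each edge of [K] that is not removed is a connected subset of [Y], so a clopen part of [Y]
    cannot cut it. *)
Lemma saturated_clopen B : closed B -> closed (Y `\` B) -> B `<=` Y ->
  saturated B.
Proof.
move=> cB cYB BY e Ee; have [eK|eK0] := satK Ee; last first.
  right; rewrite -subset0 => x [ex /BY[Kx _]]; rewrite -[set0]eK0.
  by split.
have [eF|eF] := boolP (e \in F).
  by right; rewrite -subset0 => x [ex /BY[_]]; apply; exists e.
have eY : e `<=` Y.
  move=> x ex; split; first exact: eK.
  move=> [f /= fF fx]; move: eF.
  by rewrite (edge_uniq Ee (FE fF) ex fx) fF.
have [[x [ex Bx]]|eB] := pselect (e `&` B !=set0); [left|right].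
  apply: (@connected_sub_closed _ _ _ (Y `\` B)) => //.
  - exact: connected_edge.
  - by move=> y /eY Yy; have [By|nBy] := pselect (B y); [left|right].
  - by rewrite -subset0 => y [[_ ?] []].
  - by exists x.
exact/nonemptyPn.
Qed.

Lemma weight_sub_tail B : B `<=` Y -> weight E l (edges_of B) < eta.
Proof.
move=> BY; apply: le_lt_trans etaF; apply: le_weight => // e [Ee eB].
split; first by move=> x /eB /BY[].
move=> /= eF; have [x ex] := edge_nonempty Ee.
by have [_] := BY x (eB x ex); apply; exists e.
Qed.

(** A clopen part of [B] is clopen in [Y] because [B] is. So both halves of a splitting of [B] fall
    under [clopen_contains_end]. *)
Lemma disconnected_clopen B : closed B -> closed (Y `\` B) -> B `<=` Y ->
  ~ connected B -> exists A, [/\ A `<=` B, closed A, closed (Y `\` A),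
    closed (B `\` A) & closed (Y `\` (B `\` A))] /\
    (has (mem A) ends /\ has (mem (B `\` A)) ends).
Proof.
move=> cB cYB BY /existsNP[A /not_implyP[A0 /not_implyP[[U oU AU]
  /not_implyP[[D cD AD] AB]]]]; exists A.
have AsB : A `<=` B by rewrite AD; exact: subIsetl.
have cA : closed A by rewrite AD; exact: closedI.
have cBA : closed (B `\` A).
  rewrite (_ : B `\` A = B `&` ~` U); first by apply: closedI => //;
      exact: open_closedC.
  rewrite AU; apply/seteqP; split => x [Bx nx]; split => //.
    by move=> Ux; apply: nx.
  by case.
have cYA : closed (Y `\` A).
  rewrite (_ : Y `\` A = (Y `\` B) `|` (B `\` A)); first exact: closedU.
  apply/seteqP; split => x.
    by move=> [Yx nAx]; have [Bx|nBx] := pselect (B x); [right|left].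
  by move=> [[Yx nBx]|[Bx nAx]]; split=> //; [move=> /AsB|exact: BY].
have cYBA : closed (Y `\` (B `\` A)).
  rewrite (_ : Y `\` _ = (Y `\` B) `|` A); first exact: closedU.
  apply/seteqP; split => x.
    move=> [Yx nBA]; have [Ax|nAx] := pselect (A x); [by right|left].
    by split => // Bx; apply: nBA.
  by move=> [[Yx nBx]|Ax]; split=> //; [case|exact/BY/AsB|case].
split => //; have BK : B `<=` K by move=> x /BY[].
split; apply: clopen_contains_end => //.
- exact: subset_trans BY.
- move=> KA; apply: AB; apply/seteqP; split => // x /BK; exact: KA.
- by move=> x [/BY].
- by apply/set0P/eqP; rewrite setD_eq0 => BA; apply: AB; apply/seteqP.
- by case: A0 => x Ax KBA; have [_] := KBA x (BK _ (AsB _ Ax)).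
Qed.

(** Induction on the number of listed ends in [B]: splitting a disconnected [B] gives each half at
    least one of them, so both halves have fewer. The process stops at connected sets, which are
    pieces of the first kind. *)
Lemma split_clopen n B : closed B -> closed (Y `\` B) -> B `<=` Y ->
  (count (mem B) ends < n)%N ->
  exists c, fine_cover piece eta B (weight E l (edges_of B)) c.
Proof.
elim: n B => [//|n IH] B cB cYB BY nB.
have [conB|nconB] := pselect (connected B).
  exists [:: (B, weight E l (edges_of B))]; apply: fine_cover1.
    by apply: piece_sat => //; exact: saturated_clopen.
  exact: weight_sub_tail.
have [A [[AB cA cYA cBA cYBA]]] := disconnected_clopen cB cYB BY nconB.
rewrite !has_count => -[A0 BA0].
have cnt : (count (mem A) ends + count (mem (B `\` A)) ends <=
    count (mem B) ends)%N.
  rewrite -count_predUI [X in (_ + X)%N](@eq_count _ _ pred0) ?count_pred0.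
    rewrite addn0; apply: sub_count => x /= /orP[]; rewrite !inE;
        first exact: AB.
    by case.
  by move=> x /=; apply/negP => /andP[]; rewrite !inE => Ax [].
have [||c1 c1P] := IH A cA cYA; [exact: subset_trans BY|lia|].
have [||c2 c2P] := IH (B `\` A) cBA cYBA; [by move=> x [/BY]|lia|].
exists (c1 ++ c2); have {1}-> : B = A `|` (B `\` A) by rewrite setDUK.
apply: fine_cover_le (fine_cover_cat c1P c2P).
apply: weight_disj => // [e [_ eA] x /eA /AB//|e [_ eBA] x /eBA[]//|].
rewrite -subset0 => e [[Ee eA] eBA]; have [x ex] := edge_nonempty Ee.
by have [_] := eBA x ex; apply; exact: eA.
Qed.

Lemma split_segments (r : seq (set X)) : 0 < eta -> (forall e, e \in r -> E e)
    ->
  exists c, fine_cover piece eta (\bigcup_(e in [set` r]) segment e 0 1)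
    (\sum_(e <- r) l e) c.
Proof.
move=> eta0; elim: r => [|e r IH] rE.
  exists [::]; split => //; last by rewrite !big_nil.
  by rewrite !set_nil !bigcup_set0.
have [c cP] : exists c, fine_cover piece eta (segment e 0 1) (l e * (1 - 0)) c.
  by apply: split_segment => //; exact/rE/mem_head.
have [|c' c'P] := IH; first by move=> f fr; apply: rE; rewrite inE fr orbT.
exists (c ++ c'); rewrite bigcup_seq !big_cons -bigcup_seq.
by apply: fine_cover_cat c'P; rewrite -[l e]mulr1 -[X in _ * X]subr0.
Qed.

Lemma split_saturated : 0 < eta ->
  exists c, fine_cover piece eta K (weight E l (edges_of K)) c.
Proof.
move=> eta0; have cY : closed Y.
  apply: closedI => //; apply/open_closedC/bigcup_open => e /= eF.
  exact: gs_open gsE _ (FE eF).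
have [||c1 c1P] := @split_clopen (count (mem Y) ends).+1 Y cY _ _ (ltnSn _).
- by rewrite setDv; exact: closed0.
- by [].
have [c2 c2P] := split_segments eta0 FE.
(* The closed arcs put back stay in [K], since [K] is closed and contains the edges. The weights fit
   because no removed edge lies in [Y]. *)
exists (c1 ++ c2); have {1}-> : K = Y `|` \bigcup_(e in [set` F]) segment e 0 1.
  apply/seteqP; split => x.
    move=> Kx; have [[e /= eF ex]|nx] := pselect ((\bigcup_(e in [set` F]) e)
        x).
      by right; exists e => //; apply: edge_sub_segment ex; exact: FE.
    by left.
  move=> [[]//|[e /= eF /(segment_sub_closure (FE eF))]].
  by rewrite [X in _ -> X x](iffLR (closure_id K)) //; exact/closureS/FK.
have {c1P c2P} := fine_cover_cat c1P c2P; apply: fine_cover_le.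
rewrite (weight_seq l0 lsum uF FE); apply: weight_disj => //.
- by move=> e [_ eY] x /eY[].
- by move=> e [_ /= eF]; exact: FK.
- rewrite -subset0 => e [[Ee eY] /= eF]; have [x ex] := edge_nonempty Ee.
  by have [_] := eY x ex; apply; exists e.
Qed.

End split_saturated.

Lemma split_piece eta A w : 0 < eta -> piece A w ->
  exists c, fine_cover piece eta A w c.
Proof.
move=> eta0 [{}A cA conA satA|e s t Ee s0 st t1]; last exact: split_segment.
have [F [uF FE Feta]] := weight_tail l0 lsum eta0.
apply: (@split_saturated _ _ [seq e <- F | `[< e `<=` A >]]) => //.
- by move=> e; rewrite mem_filter => /andP[_ /FE].
- by move=> e; rewrite mem_filter => /andP[/asboolP].
- exact: filter_uniq.
- apply: le_lt_trans Feta; apply: le_weight => // e [Ee [eA eF]] /= eF'.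
  by apply: eF; rewrite /= mem_filter eF' andbT; apply/asboolP.
Qed.

End graph_pieces.

(** * Separating points *)

(** Finitely many of the open sets cover [Z]; by disjointness no other one can meet it. The filter
    [F] of ever larger subfamilies extracts the finite subcover. *)
Lemma compact_finite_meet (X : topologicalType) (E : set (set X)) (Z : set X) :
  compact Z -> (forall e, E e -> open e) -> trivIset E id ->
  Z `<=` \bigcup_(e in E) e -> finite_set [set e | E e /\ e `&` Z !=set0].
Proof.
move=> /compact_near_coveringP cZ Eo tE ZE.
pose F : set_system (set (set X)) := filter_from
  [set D | finite_set D /\ D `<=` E] (fun D => [set D' | D `<=` D' /\ D' `<=`
      E]).
have FF : Filter F.
  apply: filter_from_filter; first by exists set0; split.
  move=> D D' [fD DE] [fD' D'E]; exists (D `|` D').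
    by split; [rewrite finite_setU|rewrite subUset].
  by move=> D'' []; rewrite subUset => -[DD D'D] D''E; split; split.
have [|D [fD DE] ZD] := cZ _ F (fun D x => (\bigcup_(e in D) e) x) FF.
  move=> x /ZE[e Ee ex]; exists (e, [set D | [set e] `<=` D /\ D `<=` E]).
    split => /=; first by apply: open_nbhs_nbhs; split => //; exact: Eo.
    by exists [set e] => //; split => // _ ->.
  by move=> [y D] /= [ey [eD _]]; exists e => //; exact: eD.
apply: sub_finite_set fD => e [Ee [x [ex Zx]]].
have [e' e'D e'x] := ZD D (conj (@subset_refl _ D) DE) x Zx.
suff -> : e = e' by [].
by apply: tE => //; [exact: DE|exists x].
Qed.

(** * Clopen separation in compact totally disconnected sets *)

Section quasicomponent.
Context {R : realType} {X : topologicalType} (V : set X) (x : X).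
Hypotheses (hX : hausdorff_space X) (cX : compact [set: X]) (cV : closed V).
Hypothesis Vx : V x.

(** The intersection of this family is the quasicomponent of [x] in [V]. *)
Definition clopen_around : set (set X) :=
  [set C | [/\ C `<=` V, closed C, closed (V `\` C) & C x]].

Let clopen_aroundI C D :
  clopen_around C -> clopen_around D -> clopen_around (C `&` D).
Proof.
move=> [CV cC cVC Cx] [DV cD cVD Dx]; split => //.
- by move=> y [/CV].
- exact: closedI.
- by rewrite setDIr; exact: closedU.
Qed.

Let clopen_around_half C U U' : open U -> open U' -> U `&` U' = set0 ->
  C `<=` U `|` U' -> clopen_around C -> U x -> clopen_around (C `&` U).
Proof.
move=> oU oU' UU' CUU' [CV cC cVC Cx] Ux.
have nUU' y : U y -> U' y -> False by move=> Uy U'y;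
    rewrite -[False]/(set0 y) -UU'.
split => //; first by move=> y [/CV].
  rewrite (_ : C `&` U = C `&` ~` U'); first by apply: closedI => //;
      exact: open_closedC.
  by apply/seteqP; split => y [Cy Uy]; split => //;
      [exact: nUU'|case: (CUU' y Cy)].
rewrite (_ : V `\` _ = (V `\` C) `|` (C `&` ~` U)).
  by apply: closedU => //; apply: closedI => //; exact: open_closedC.
apply/seteqP; split => y.
  move=> [Vy nCU]; have [Cy|nCy] := pselect (C y); [right|by left].
  by split => // Uy; apply: nCU.
by move=> [[Vy nCy]|[Cy nUy]]; split; [|case|exact: CV|case].
Qed.

(* A splitting of the intersection of the relatively clopen sets around [x]
   extends, by normality and compactness, to a splitting of one of these sets,
   and the half that contains [x] is again relatively clopen. *)
Lemma quasicomponent_connected : connected (\bigcap_(C in clopen_around) C).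
Proof.
set Q := \bigcap_(C in _) C => B B0 [U oU BU] [D cD BD].
have VV : clopen_around V by split; rewrite ?setDv //; exact: closed0.
have cQ : closed Q by apply: closed_bigI => C [].
have cB : closed B by rewrite BD; exact: closedI.
have cQB : closed (Q `\` B).
  rewrite (_ : Q `\` B = Q `&` ~` U).
    by apply: closedI => //; exact: open_closedC.
  rewrite BU; apply/seteqP; split => y [Qy nU]; split => //; last by case.
  by move=> Uy; apply: nU.
have /(@normal_openP R) /(_ _ _ cB cQB) := compact_normal hX cX.
case=> [|U1 [U2 [oU1 oU2 BU1 QU2 U12]]]; first by rewrite setDE setIC -setIA
    setICl setI0.
have /compact_near_coveringP cK : compact (V `&` ~` (U1 `|` U2)).
  apply: (subclosed_compact _ cX) => //; apply: closedI => //.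
  by apply: open_closedC; exact: openU.
(* Along this filter the relatively clopen sets around [x] shrink to [Q]. As [Q] misses the compact
   part of [V] outside [U1] and [U2], so does one of them. *)
pose F : set_system (set X) :=
  filter_from clopen_around (fun C => [set D | D `<=` C /\ clopen_around D]).
have FF : Filter F.
  apply: filter_from_filter; first by exists V.
  move=> C C' fC fC'; exists (C `&` C'); first exact: clopen_aroundI.
  by move=> C'' []; rewrite subsetI => -[CC CC'] fC''; split; split.
have [|C fC KC] := cK _ F (fun C y => ~ C y) FF.
  move=> y [Vy nUy]; have nQy : ~ Q y.
    move=> Qy; apply: nUy; have [By|nBy] := pselect (B y); first by left;
        exact: BU1.
    by right; apply: QU2.
  have [C fC nCy] : exists2 C, clopen_around C & ~ C y.
    by apply: contrapT => nC; apply: nQy => C fC; apply: contrapT => ?;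
        apply: nC; exists C.
  exists (~` C, [set D | D `<=` C /\ clopen_around D]); last first.
    by move=> [z D'] /= [nCz [D'C _]] /D'C.
  split => /=; last by exists C.
  by apply: open_nbhs_nbhs; split => //; apply: closed_openC; case: fC.
have {}KC : C `<=` U1 `|` U2.
  move=> y Cy; apply: contrapT => nU; apply: (KC C _ y _ Cy); first by split.
  by split => //; case: fC => + _ _ _; apply.
have QC D' : clopen_around D' -> Q `<=` D' by move=> fD' y; exact.
have Cx : C x by case: fC.
have disj y : U1 y -> U2 y -> False by move=> U1y U2y;
    rewrite -[False]/(set0 y) -U12.
case: (KC x Cx) => [U1x|U2x].
  have QU1 := QC _ (clopen_around_half oU1 oU2 U12 KC fC U1x).
  apply/seteqP; split => [y|y Qy]; first by rewrite BD => -[].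
  apply: contrapT => nBy; apply: (disj y); last by apply: QU2.
  by case: (QU1 y Qy).
rewrite setIC in U12; rewrite setUC in KC.
have QU2' := QC _ (clopen_around_half oU2 oU1 U12 KC fC U2x).
case: B0 => y By; exfalso; apply: (disj y); first exact: BU1.
by have [] : (C `&` U2) y by apply: QU2'; move: By; rewrite BD => -[].
Qed.

(** If no clopen set told [y] from [x], both would lie in the quasicomponent, a connected subset of
    [V]. *)
Lemma totally_disconnected_split y : totally_disconnected V -> V y -> y <> x ->
  exists C, [/\ C `<=` V, closed C, closed (V `\` C), C x & ~ C y].
Proof.
move=> tdV Vy yx; apply: contrapT => nC.
have : connected_component V x y; last by rewrite tdV.
apply: (connected_component_max _ _ quasicomponent_connected).
- by move=> C [].
- by move=> z /(_ V); apply; split; rewrite ?setDv //; exact: closed0.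
- move=> C [CV cC cVC Cx]; apply: contrapT => nCy; apply: nC; exists C.
  by split.
Qed.

End quasicomponent.

(** * Functions whose oscillation on pieces is controlled by the weight *)

Section graph_separation.
Context {R : realType} {X : topologicalType}.
Context {E : set (set X)} {g : set X -> R -> X} {l : set X -> R}.
Hypothesis gsE : graph_structure E g l.
Implicit Types (e A : set X) (x y : X) (s t : R).

Local Notation V := (~` \bigcup_(e in E) e).
Local Notation segment := (@segment R X g).
Local Notation piece := (@piece R X E g l).
Local Notation saturated := (@saturated X E).

Let l0 := gs_gt0 gsE.
Let lsum := gs_summable gsE.

Lemma le_weight_edge A e : E e -> e `<=` A -> l e <= weight E l (edges_of A).
Proof.
move=> Ee eA; rewrite -(weight1 l0 lsum Ee); apply: le_weight => //.
by move=> _ [_ ->].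
Qed.

Definition coord e x : R := xget 0 [set t | t \in `[0, 1] /\ g e t = x].

Lemma coordK e t : E e -> 0 <= t <= 1 -> coord e (g e t) = t.
Proof.
move=> Ee t01; rewrite /coord; case: xgetP => [s _ [s01 gst]|/(_ t)].
  exact: (gs_inj gsE Ee).
by case; split => //; rewrite in_itv.
Qed.

Lemma coord_edge e x : E e -> e x -> 0 <= coord e x <= 1 /\ g e (coord e x) = x.
Proof.
move=> Ee /(edge_sub_segment gsE Ee)[t /=]; rewrite in_itv /= => t01 <-.
by rewrite coordK.
Qed.

Definition edge_at x : set X := xget set0 [set e | E e /\ e x].

Lemma edge_atE e x : E e -> e x -> edge_at x = e.
Proof.
move=> Ee ex; rewrite /edge_at; case: xgetP => [e' _ [Ee' e'x]|/(_ e)].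
  exact: (edge_uniq gsE Ee' Ee e'x ex).
by case.
Qed.

(** At vertices, where [edge_at] takes its default value, only [u] is read. *)
Definition extend (u : X -> R) (phi : set X -> R -> R) x : R :=
  if `[< V x >] then u x else phi (edge_at x) (coord (edge_at x) x).

Lemma extendV u phi x : V x -> extend u phi x = u x.
Proof. by move=> Vx; rewrite /extend asboolT. Qed.

Lemma extend_edge u phi e x : E e -> e x ->
  extend u phi x = phi e (coord e x).
Proof.
move=> Ee ex; rewrite /extend asboolF ?(edge_atE Ee ex) //.
by apply; exists e.
Qed.

Lemma extend_segment u phi e t : E e -> 0 <= t <= 1 ->
  phi e 0 = u (g e 0) -> phi e 1 = u (g e 1) -> extend u phi (g e t) = phi e t.
Proof.
move=> Ee t01 p0 p1; case: (segmentP gsE Ee t01) => [->|->|et].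
- by rewrite extendV //; apply: (end_in_vertices gsE) => //; left.
- by rewrite extendV //; apply: (end_in_vertices gsE) => //; right.
- by rewrite (extend_edge _ _ Ee et) coordK.
Qed.

Definition separated_points x y := exists (f : X -> R) (M : R), [/\ 0 < M,
  forall A w a b, piece A w -> A a -> A b -> `|f a - f b| <= M * w & f x != f
      y].

Lemma separated_pointsC x y : separated_points x y -> separated_points y x.
Proof. by move=> [f [M [? ? ?]]]; exists f, M; split => //; rewrite eq_sym. Qed.

Lemma separated_points_chain x y : separated_points x y ->
  exists2 e : R, 0 < e & forall L, chain piece x y L -> e <= L.
Proof.
move=> [f [M [M0 fM fxy]]]; exists (`|f x - f y| / M).
  by rewrite divr_gt0 // normr_gt0 subr_eq0.
by move=> L c; rewrite ler_pdivrMr // mulrC; exact: chain_ge_dist fM c.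
Qed.

(** As [phi] agrees with [u] at the ends, the function is [phi e] on the whole closed arc, and the
    Lipschitz bound settles the pieces that are arcs. *)
Lemma separated_points_extend u phi M x y : 0 < M ->
  (forall e, E e -> phi e 0 = u (g e 0) /\ phi e 1 = u (g e 1)) ->
  (forall e s t, E e -> `|phi e s - phi e t| <= M * (l e * `|s - t|)) ->
  (forall A a b, closed A -> connected A -> saturated A -> A a -> A b ->
    `|extend u phi a - extend u phi b| <= M * weight E l (edges_of A)) ->
  extend u phi x != extend u phi y -> separated_points x y.
Proof.
move=> M0 uphi lip sat fxy; exists (extend u phi), M; split => //.
move=> A w a b [{}A cA conA satA|e s t Ee s0 st t1]; first exact: sat.
move=> [a' /= + <-] [b' /= + <-]; rewrite !in_itv /= => /andP[sa at_] /andP[sb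
    bt].
have [p0 p1] := uphi e Ee.
rewrite !extend_segment //; [|by apply/andP; split; lra..].
apply: (le_trans (lip e _ _ Ee)); rewrite !ler_pM2l ?l0 //.
by rewrite ler_norml; lra.
Qed.

Lemma separated_edge e x y : E e -> e x -> y <> x -> separated_points x y.
Proof.
move=> Ee ex yx; have [t01 gt] := coord_edge Ee ex.
set t := coord e x in t01 gt.
have [t0 t1] : 0 < t /\ t < 1.
  move: t01 => /andP[]; rewrite !le_eqVlt => /predU1P[tE|->].
    have [] := end_in_vertices gsE Ee (or_introl (esym tE)).
    by exists e => //; rewrite gt.
  move=> /predU1P[tE|->] //.
  have [] := end_in_vertices gsE Ee (or_intror tE).
  by exists e => //; rewrite gt.
(* With this radius the tent vanishes at both ends of [e] and peaks only at [x]. It is at most 1, so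
   [1 / l e] serves as constant: a saturated piece contains [e] and weighs at least [l e], or misses
   [e] and sees only 0. *)
pose r := Num.min t (1 - t).
have [r0 rt rt1 r1] : [/\ 0 < r, r <= t, r <= 1 - t & r <= 1].
  by rewrite /r lt_min !ge_min; split; lra.
pose tent s := Num.max 0 (r - `|s - t|).
have tent01 s : 0 <= tent s <= 1.
  by rewrite le_max lexx /= ge_max ler01 /=; have := normr_ge0 (s - t); lra.
have tentL s s' : `|tent s - tent s'| <= `|s - s'|.
  have := ler_dist_dist (s - t) (s' - t); rewrite opprB addrA subrK.
  rewrite /tent /Num.max !ler_norml; case: ifP; case: ifP; lra.
have tent_far s : r <= `|s - t| -> tent s = 0.
  by move=> rs; apply/max_idPl; rewrite subr_le0.
pose phi e' s := if e' == e then tent s else 0.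
have le0 := l0 Ee.
have off a : ~ e a -> extend (cst 0) phi a = 0.
  rewrite /extend; case: ifPn => // /asboolPn/contrapT[e' Ee' e'a] nea.
  rewrite (edge_atE Ee' e'a) /phi; case: eqP => // e'e.
  by case: nea; rewrite -e'e.
apply: (@separated_points_extend (cst 0) phi (l e)^-1).
- by rewrite invr_gt0.
- move=> e' Ee'; rewrite /phi; case: eqP => // _; rewrite !tent_far //.
    by rewrite ler_normr; lra.
  by rewrite ler_normr; lra.
- move=> e' s s' Ee'; rewrite /phi; case: eqP => [->|_].
    by rewrite mulKf ?gt_eqF.
  by rewrite subrr normr0 !mulr_ge0 // ?invr_ge0 ?ltW // l0.
- move=> A a b cA conA satA Aa Ab; case: (satA e Ee) => [eA|eA0].
    apply: (@le_trans _ _ 1); last first.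
      by rewrite -(ler_pM2l le0) mulVKf ?gt_eqF // mulr1 le_weight_edge.
    have ext01 c : 0 <= extend (cst 0) phi c <= 1.
      rewrite /extend; case: ifP => _ /=; first by rewrite lexx ler01.
      by rewrite /phi; case: eqP => _ //; rewrite lexx ler01.
    by have := ext01 a; have := ext01 b; rewrite ler_norml; lra.
  have nA c : A c -> ~ e c by move=> Ac ec; rewrite -[False]/(set0 c) -eA0.
  rewrite !off ?subrr ?normr0 ?mulr_ge0 ?invr_ge0 ?(ltW le0) ?weight_ge0 //;
    exact: nA.
- rewrite (extend_edge _ _ Ee ex) /phi eqxx -/t.
  have tt : tent t = r by rewrite /tent subrr normr0 subr0; apply/max_idPr/ltW.
  have [ey|ney] := pselect (e y); last by rewrite off // tt gt_eqF.
  rewrite (extend_edge _ _ Ee ey) eqxx tt gt_eqF // /tent gt_max r0 /=.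
  rewrite ltrBlDr ltrDl normr_gt0 subr_eq0; apply/eqP => cyt; apply: yx.
  by have [_ <-] := coord_edge Ee ey; rewrite cyt.
Qed.

Lemma closed_vertices : closed V.
Proof. by apply/open_closedC/bigcup_open => e Ee; exact: (gs_open gsE). Qed.

Section vertex_partition.
Variables V0 V1 U0 U1 : set X.
Hypotheses (VE : V `<=` V0 `|` V1) (V0U0 : V0 `<=` U0) (V1U1 : V1 `<=` U1).
Hypotheses (oU0 : open U0) (oU1 : open U1) (U01 : U0 `&` U1 = set0).

Let Z := ~` (U0 `|` U1).

Let disjU x : U0 x -> U1 x -> False.
Proof. by move=> ? ?; rewrite -[False]/(set0 x) -U01. Qed.

Definition far_edges : set (set X) := [set e | E e /\ e `&` Z !=set0].

Lemma finite_far_edges : finite_set far_edges.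
Proof.
apply: compact_finite_meet; [|exact: (gs_open gsE)|exact: (gs_triv gsE)|].
  by apply: subclosed_compact (gs_compact gsE) _ => //;
      exact/open_closedC/openU.
move=> x; rewrite /Z => nUx; apply: contrapT => /VE[/V0U0|/V1U1] Ux; apply: nUx.
  by left.
by right.
Qed.

(** Such an edge is connected and covered by the disjoint [U0] and [U1], so it misses [U0]. An end
    in [V0] would have [U0] as a neighborhood and be outside the closure of the edge. *)
Lemma near_edge_ends e t : E e -> ~ far_edges e -> e `&` U1 !=set0 ->
  t = 0 \/ t = 1 -> V1 (g e t).
Proof.
move=> Ee nfar eU1 t01; have Vt := end_in_vertices gsE Ee t01.
have cle : closure e (g e t).
  apply: (segment_sub_closure gsE Ee); exists t => //=.
  by case: t01 => ->; rewrite in_itv /= ?lexx ?ler01.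
have eU : e `<=` U0 `|` U1.
  by move=> x ex; apply: contrapT => nUx; apply: nfar; split => //; exists x.
case: (VE Vt) => // /V0U0 U0t; exfalso.
have [z [ez U0z]] := cle U0 (open_nbhs_nbhs (conj oU0 U0t)).
case: eU1 => y [ey U1y]; apply: (disjU U0z).
suff : e `<=` ~` U0 by move=> /(_ z ez).
apply: (@connected_sub_closed _ _ _ (~` U1)).
- exact: (connected_edge gsE).
- exact: open_closedC.
- exact: open_closedC.
- move=> x ex; have [U0x|nU0x] := pselect (U0 x); last by left.
  by right => U1x; exact: disjU U0x U1x.
- by rewrite -subset0 => x [[ex nU0] nU1]; case: (eU x ex).
- by exists y; split => // U0y; exact: disjU U0y U1y.
Qed.

(** When no edge in [A] joins [V0] to [V1], this is the part of [A] on which the interpolated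
    indicator of [V0] equals 1. *)
Definition side A : set X :=
  [set a | A a /\ (V0 a \/ exists e, [/\ E e, e a & V0 (g e 0)])].

End vertex_partition.

(* Near a point of [V1], points of [side V0 A] can only lie on the finitely many
   edges that leave both [U0] and [U1]. *)
Lemma closed_side V0 V1 U0 U1 A : V `<=` V0 `|` V1 ->
  V0 `<=` U0 -> V1 `<=` U1 -> open U0 -> open U1 -> U0 `&` U1 = set0 ->
  V0 `<=` V -> V1 `<=` V -> closed A -> saturated A ->
  (forall e, E e -> e `<=` A -> V0 (g e 0) -> V0 (g e 1)) ->
  closed (side V0 A).
Proof.
move=> VE V0U0 V1U1 oU0 oU1 U01 V0V V1V cA satA same p clp.
have V01 x : V0 x -> V1 x -> False.
  by move=> /V0U0 ? /V1U1 ?; rewrite -[False]/(set0 x) -U01.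
have Ap : A p by apply: cA; apply: closureS clp => x [].
have edge_in e x : E e -> e x -> A x -> e `<=` A.
  move=> Ee ex Ax; case: (satA e Ee) => // eA0.
  by exfalso; rewrite -[False]/(set0 x) -eA0.
split => //; have [[e Ee ep]|Vp] := pselect ((\bigcup_(e in E) e) p).
  right; exists e; split => //.
  have [q [[Aq V0q] eq]] := clp e (open_nbhs_nbhs (conj (gs_open gsE Ee) ep)).
  case: V0q => [/V0V[]|[e' [Ee' e'q V0e']]]; first by exists e.
  by rewrite (edge_uniq gsE Ee Ee' eq e'q).
case: (VE p Vp) => [|V1p]; [by left|exfalso].
(* The closed arcs of these finitely many edges have a closed union that avoids [p], so it can be
   removed from the neighborhood [U1] of [p]. *)
pose T := [set e | far_edges U0 U1 e /\ V0 (g e 0) /\ V0 (g e 1)].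
have cT : closed (\bigcup_(e in T) segment e 0 1).
  apply: closed_bigcup => [|e [[Ee _] _]]; last exact: (closed_segment gsE).
  apply: (@sub_finite_set _ _ (far_edges U0 U1)) => [e []//|].
  exact: finite_far_edges VE V0U0 V1U1 oU0 oU1.
have /clp[q [[Aq V0q] [U1q nTq]]] : nbhs p (U1 `&` ~` \bigcup_(e in T) segment
    e 0 1).
  apply: open_nbhs_nbhs; split; first by apply: openI => //;
      exact: closed_openC.
  split; first exact: V1U1.
  move=> [e [[Ee _] [e0 e1]] /(segmentE gsE Ee)[ep|pe|pe]].
  - by apply: Vp; exists e.
  - by apply: (V01 p) => //; rewrite pe.
  - by apply: (V01 p) => //; rewrite pe.
case: V0q => [/V0U0 U0q|[e [Ee eq V0e]]]; first by rewrite -[False]/(set0 q)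
    -U01.
have V0e1 := same e Ee (edge_in e q Ee eq Aq) V0e.
have [efar|enear] := pselect (far_edges U0 U1 e).
  by apply: nTq; exists e => //; exact: (edge_sub_segment gsE).
apply: (V01 _ V0e); apply: (near_edge_ends VE V0U0 oU0 oU1 U01 Ee enear).
  by exists q.
by left.
Qed.

Lemma separated_vertices x y : V x -> V y -> y <> x -> separated_points x y.
Proof.
move=> Vx Vy yx.
have [V0 [V0V cV0 cV1 V0x nV0y]] := @totally_disconnected_split R X V x
  (gs_hausdorff gsE) (gs_compact gsE) closed_vertices Vx y (gs_vertices gsE) Vy
      yx.
pose V1 := V `\` V0.
have VE : V `<=` V0 `|` V1.
  by move=> z Vz; have [?|?] := pselect (V0 z); [left|right].
have VE' : V `<=` V1 `|` V0 by rewrite setUC.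
have V1V : V1 `<=` V by move=> z [].
have := compact_normal (gs_hausdorff gsE) (gs_compact gsE).
move=> /(@normal_openP R)/(_ _ _ cV0 cV1)[|U0 [U1 [oU0 oU1 V0U0 V1U1 U01]]].
  by rewrite setDE setICA setICr setI0.
have fin := finite_far_edges VE V0U0 V1U1 oU0 oU1.
have U10 : U1 `&` U0 = set0 by rewrite setIC.
pose u z : R := (z \in V0)%:R.
have u0 z : V0 z -> u z = 1 by move=> V0z; rewrite /u mem_set.
have u1 z : V1 z -> u z = 0 by move=> [_ nV0z]; rewrite /u memNset.
pose phi e t := u (g e 0) * (1 - t) + u (g e 1) * t.
(* [M] exceeds the sum of the inverse lengths of the finitely many far edges, the only ones along
   which [phi] can vary. *)
have [M M0 MT] : exists2 M, 0 < M & forall e, far_edges U0 U1 e -> 1 <= M * l e.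
  have [s sT] := iffLR (finite_seqP _) fin.
  have sum0 (r : seq (set X)) : {subset r <= s} -> 0 <= \sum_(e <- r) (l e)^-1.
    move=> rs; rewrite big_seq; apply: sumr_ge0 => e /rs es.
    have [Ee _] : far_edges U0 U1 e by rewrite sT.
    by rewrite invr_ge0 ltW // l0.
  exists (1 + \sum_(e <- s) (l e)^-1); first by rewrite ltr_pwDl // sum0.
  move=> e fe; have le0 : 0 < l e by case: fe => /l0.
  have es : e \in s by move: fe; rewrite sT.
  rewrite -[leLHS](mulVf (lt0r_neq0 le0)) ler_pM2r // (big_rem e es) /=.
  rewrite addrCA lerDl addr_ge0 // sum0 // => e'; exact: mem_rem.
have cross e : E e -> u (g e 0) = u (g e 1) \/ far_edges U0 U1 e.
  move=> Ee; have [|nfar] := pselect (far_edges U0 U1 e); [by right|left].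
  have nfar' : ~ far_edges U1 U0 e by rewrite /far_edges setUC.
  have [z ez] := edge_nonempty gsE Ee.
  have : (U0 `|` U1) z by apply: contrapT => nUz; apply: nfar; split => //;
      exists z.
  case=> Uz.
    have eU : e `&` U0 !=set0 by exists z.
    rewrite !u0 //; apply: (near_edge_ends VE' V1U1 oU1 oU0 U10 Ee nfar' eU).
      by right.
    by left.
  have eU : e `&` U1 !=set0 by exists z.
  rewrite !u1 //; apply: (near_edge_ends VE V0U0 oU0 oU1 U01 Ee nfar eU).
    by right.
  by left.
have u01 z : 0 <= u z <= 1 by rewrite /u; case: (_ \in _); rewrite ?lexx ?ler01.
have ext01 z : 0 <= extend u phi z <= 1.
  have [[e Ee ez]|Vz] := pselect ((\bigcup_(e in E) e) z);
      last by rewrite extendV.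
  have [/andP[t0 t1] _] := coord_edge Ee ez.
  rewrite (extend_edge u phi Ee ez) /phi.
  have /andP[a0 a1] := u01 (g e 0); have /andP[b0 b1] := u01 (g e 1).
  have t1' : 0 <= 1 - coord e z by rewrite subr_ge0.
  rewrite addr_ge0 ?mulr_ge0 //=.
  by have := ler_wpM2r t1' a1; have := ler_wpM2r t0 b1; lra.
apply: (@separated_points_extend u phi M) => //.
- by move=> e Ee; rewrite /phi subrr subr0 !mulr0 !mulr1 addr0 add0r.
- move=> e s t Ee; have [ue|fe] := cross e Ee.
    rewrite /phi ue -!mulrDr !subrK !mulr1 subrr normr0 !mulr_ge0 // ltW //.
    exact: l0.
  rewrite (_ : phi e s - phi e t = (u (g e 1) - u (g e 0)) * (s - t));
      last first.
    by rewrite /phi; ring.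
  rewrite normrM mulrA ler_wpM2r // (le_trans _ (MT e fe)) //.
  by have := u01 (g e 0); have := u01 (g e 1); rewrite ler_norml; lra.
- move=> A a b cA conA satA Aa Ab.
  (* An edge in [A] with different end values is far, so [M] times the weight is at least 1, the
     full range of the function. Otherwise the two sides of [A] are closed and disjoint, and
     connectedness makes the function constant on [A]. *)
  have [[e [Ee eA ue]]|nocross] := pselect
      (exists e, [/\ E e, e `<=` A & u (g e 0) <> u (g e 1)]).
    have [//|fe] := cross e Ee.
    apply: (@le_trans _ _ 1); last first.
      by rewrite (le_trans (MT e fe)) // ler_pM2l // le_weight_edge.
    by have := ext01 a; have := ext01 b; rewrite ler_norml; lra.
  have uE e : E e -> e `<=` A -> u (g e 0) = u (g e 1).
    by move=> Ee eA; apply: contrapT => ue; apply: nocross; exists e.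
  have edge_in e z : E e -> e z -> A z -> e `<=` A.
    move=> Ee ez Az; case: (satA e Ee) => // eA0.
    by exfalso; rewrite -[False]/(set0 z) -eA0.
  have cS0 : closed (side V0 A).
    apply: (closed_side VE V0U0 V1U1 oU0 oU1 U01) => // e Ee eA V0e.
    apply: contrapT => nV0; have := uE e Ee eA; rewrite u0 // u1.
      by move/eqP; rewrite oner_eq0.
    by split => //; apply: (end_in_vertices gsE) => //; right.
  have cS1 : closed (side V1 A).
    apply: (closed_side VE' V1U1 V0U0 oU1 oU0 U10) => // e Ee eA V1e.
    split; first by apply: (end_in_vertices gsE) => //; right.
    move=> V0e; have := uE e Ee eA; rewrite u1 // u0 //.
    by move/eqP; rewrite eq_sym oner_eq0.
  have ext_side W c z : W `<=` V -> (forall v, W v -> u v = c) -> side W A z ->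
      extend u phi z = c.
    move=> WV Wu [Az]; have [[e Ee ez]|Vz] := pselect ((\bigcup_(e in E) e) z).
      rewrite (extend_edge u phi Ee ez) /phi -(uE e Ee (edge_in e z Ee ez Az)).
      rewrite -mulrDr subrK mulr1 => -[/WV[]|[e' [Ee' e'z /Wu <-]]];
          first by exists e.
      by rewrite (edge_uniq gsE Ee Ee' ez e'z).
    by move=> [/Wu|[e [Ee ez _]]]; [rewrite extendV|case: Vz; exists e].
  have AS : A `<=` side V0 A `|` side V1 A.
    move=> z Az; have [[e Ee ez]|Vz] := pselect ((\bigcup_(e in E) e) z).
      have [V0e|V1e] := VE _ (end_in_vertices gsE Ee (or_introl erefl)).
        by left; split => //; right; exists e.
      by right; split => //; right; exists e.
    by case: (VE z Vz) => Vz'; [left|right]; split => //; left.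
  have [AS0|AS0] := pselect (A `&` side V0 A !=set0).
    suff AS0' : A `<=` side V0 A.
      by rewrite !(ext_side _ _ _ V0V u0) ?subrr ?normr0 ?mulr_ge0 ?weight_ge0
          ?ltW //;
        exact: AS0'.
    apply: (connected_sub_closed conA cS0 cS1 AS) => //.
    rewrite -subset0 => z [[_ S0z] S1z].
    have := ext_side _ _ _ V1V u1 S1z; rewrite (ext_side _ _ _ V0V u0 S0z).
    by move/eqP; rewrite oner_eq0.
  suff AS1 : A `<=` side V1 A.
    by rewrite !(ext_side _ _ _ V1V u1) ?subrr ?normr0 ?mulr_ge0 ?weight_ge0
        ?ltW //;
      exact: AS1.
  by move=> z Az; case: (AS z Az) => // S0z; exfalso; apply: AS0; exists z.
- by rewrite !extendV // u0 // u1 ?oner_eq0.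
Qed.

Lemma separated_neq x y : x <> y -> separated_points x y.
Proof.
move=> xy; have [[e Ee ex]|Vx] := pselect ((\bigcup_(e in E) e) x).
  by apply: (separated_edge Ee ex) => yx; apply: xy.
have [[e Ee ey]|Vy] := pselect ((\bigcup_(e in E) e) y).
  by apply: separated_pointsC; exact: (separated_edge Ee ey).
by apply: separated_vertices => // yx; apply: xy.
Qed.

Lemma piece_system_graph : piece_system piece.
Proof.
split.
- by move=> A w [//|e s t Ee s0 st t1]; exact: (closed_segment gsE).
- by move=> A w [//|e s t Ee s0 st t1]; exact: (connected_segment gsE).
- move=> A w [{}A _ _ _|e s t Ee s0 st t1]; first exact: weight_ge0.
  by rewrite mulr_ge0 ?subr_ge0 // ltW // l0.
- by move=> A w eta PA eta0; exact: (split_piece gsE).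
- by move=> x y /separated_neq; exact: separated_points_chain.
Qed.

Lemma piece_setT : piece [set: X] (weight E l (edges_of [set: X])).
Proof.
apply: piece_sat; [exact: closedT|exact: gs_connected gsE|].
by move=> e _; left.
Qed.

End graph_separation.

(** * Parametrized edges *)

Section edge_parametrization.
Context {R : realType} {X : topologicalType}.

(** Trades the maps between subtypes for a total map, constant off [I]. *)
Lemma homeomorphic_param (A : set X) (I : set R) :
  [set: X] !=set0 -> homeomorphic A I -> exists h : R -> X,
    [/\ {within I, continuous h}, {in I &, injective h} & h @` I = A].
Proof.
move=> [x0 _] [f [k [fk kf _ ck]]].
pose h t := if pselect (I t) is left It then \val (k (SigSub (mem_set It)))
    else x0.
have hE (u : I) : h (\val u) = \val (k u).
  rewrite /h; case: pselect => [It|/(_ (set_mem (valP u)))//].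
  by congr (\val (k _)); apply: val_inj.
exists h; split.
- apply/subspace_sigL_continuousP.
  rewrite (_ : sigL I h = \val \o k); last by apply/funext => u; exact: hE.
  by move=> u; apply: continuous_comp; [exact: ck|exact: initial_continuous].
- move=> s t Is It; have := hE (SigSub Is); have := hE (SigSub It) => /= -> ->.
  by move/val_inj/(can_inj kf)/(congr1 \val).
- apply/seteqP; split => [_ [t It <-]|x Ax].
    by have /= -> := hE (SigSub (mem_set It)); exact/set_mem/valP.
  exists (\val (f (SigSub (mem_set Ax)))); first exact/set_mem/valP.
  by rewrite hE fk.
Qed.

(* The open arc [h @` `]0, 1[] replaces the edge [e]: the hypotheses do not say
   directly that the ends of the closure of [e] are outside [e]. *)
Lemma edge_param (e : set X) : hausdorff_space X -> [set: X] !=set0 -> edge R e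
    ->
  exists h : R -> X, [/\ {within `[0, 1], continuous h},
    {in `[0, 1] &, injective h}, open (h @` `]0, 1[), h @` `]0, 1[ `<=` e &
    e `\` (h @` `]0, 1[) `<=` [set h 0; h 1] ].
Proof.
move=> hX X0 [oe /(homeomorphic_param X0)[k [ck _ ke]]].
move=> /(homeomorphic_param X0)[h [ch hinj hcl]].
have conne : connected e.
  rewrite -ke; apply: connected_continuous_connected ck.
  exact/connected_intervalP/interval_is_interval.
have T1 := iffLR accessible_finite_set_closed (hausdorff_accessible hX).
have ecl x : e x -> exists2 t, 0 <= t <= 1 & h t = x.
  move=> /subset_closure; rewrite -hcl => -[t /=]; rewrite in_itv /= => t01 <-.
  by exists t.
have {}hinj s t : 0 <= s <= 1 -> 0 <= t <= 1 -> h s = h t -> s = t.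
  by move=> s01 t01; apply: hinj; rewrite mem_setE in_itv.
have harc (a b : R) : 0 <= a -> b <= 1 -> closed (h @` `[a, b]).
  move=> a0 b1; apply: (compact_closed hX); apply: continuous_compact.
    apply: continuous_subspaceW ch => t /=; rewrite !in_itv /= => /andP[at_ tb].
    by rewrite (le_trans a0) // (le_trans tb).
  exact: segment_compact.
have hclos t : 0 <= t <= 1 -> closure e (h t).
  by move=> t01; rewrite -hcl; exists t => //=; rewrite in_itv.
(* If [h t] were missing from [e], the arcs before and after [t] would split the connected [e], so
   [e] would lie in one of them. That arc is closed and misses an end, while the closure of [e]
   contains both. *)
have he t : 0 < t < 1 -> e (h t).
  move=> /andP[t0 t1]; apply: contrapT => net.
  have t01 : 0 <= t <= 1 by rewrite !ltW.
  have nsub (a b c : R) : 0 <= a -> b <= 1 -> 0 <= c <= 1 -> ~~ (a <= c <= b) ->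
      ~ e `<=` h @` `[a, b].
    move=> a0 b1 c01 cab eab; have : closure (h @` `[a, b]) (h c).
      by apply: closureS eab _ _; exact: hclos.
    rewrite -(iffLR (closure_id _)); last exact: harc.
    move=> [s /=]; rewrite in_itv /= => sab hsc; move: cab.
    rewrite -(hinj s c) // ?sab //; move: sab => /andP[as_ sb].
    by rewrite (le_trans a0) // (le_trans sb).
  have cov : e `<=` h @` `[0, t] `|` h @` `[t, 1].
    move=> x /ecl[s /andP[s0 s1] <-]; have [st|ts] := leP s t.
      by left; exists s => //=; rewrite in_itv /= s0.
    by right; exists s => //=; rewrite in_itv /= s1 ltW.
  have dis : e `&` h @` `[0, t] `&` h @` `[t, 1] = set0.
    rewrite -subset0 => x [[ex [s /=]]]; rewrite in_itv /= => /andP[s0 st] hs.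
    move=> [s' /=]; rewrite in_itv /= => /andP[ts' s'1] hs'.
    have ss' : s = s'.
      apply: hinj; rewrite ?hs ?hs' // ?s0 ?s'1 ?andbT ?(le_trans st) ?ltW //.
      exact: lt_le_trans t0 ts'.
    have st' : s = t by apply/eqP; rewrite eq_le st ss' ts'.
    by apply: net; rewrite -st' hs.
  have [e0t|e0t] := pselect (e `&` h @` `[0, t] !=set0).
    apply: (nsub 0 t 1); rewrite ?lexx ?ler01 ?(ltW t1) ?(lt_geF t1) //.
    by apply: connected_sub_closed dis e0t => //; apply: harc => //; exact: ltW.
  apply: (nsub t 1 0); rewrite ?lexx ?ler01 ?(ltW t0) ?(lt_geF t0) //.
  by move=> x ex; case: (cov x ex) => // ?; exfalso; apply: e0t; exists x.
have arcE : h @` `]0, 1[ = e `&` ~` [set h 0; h 1].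
  apply/seteqP; split => x.
    move=> [t /=]; rewrite in_itv /= => t01 <-; split; first exact: he.
    move: t01 => /andP[t0 t1]; have t01 : 0 <= t <= 1 by rewrite !ltW.
    case=> ht; [move: t0|move: t1].
      by rewrite (hinj t 0) ?ltxx // lexx ler01.
    by rewrite (hinj t 1) ?ltxx // lexx ler01.
  move=> [/ecl[t /andP[]]]; rewrite !le_eqVlt => /predU1P[<-|t0].
    by move=> _ <- []; left.
  move=> /predU1P[->|t1] <-; first by case; right.
  by move=> _; exists t => //=; rewrite in_itv /= t0.
exists h; split => //.
- by rewrite arcE; apply: openI => //; apply: closed_openC; exact: T1.
- by rewrite arcE; exact: subIsetl.
- rewrite arcE => x [ex nx]; apply: contrapT => hx; apply: nx; split => //.
Qed.

End edge_parametrization.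

(** Only finitely many edges leave the neighborhood [W n] of the vertices, by compactness. Each edge
    contains a ball around one of its points, which is then outside [W n] for some [n]. *)
Lemma countable_open_edges {R : realType} {X : topologicalType}
    (d : X -> X -> R) (E : set (set X)) :
  is_metric d -> compatible d -> compact [set: X] ->
  (forall e, E e -> open e) -> (forall e, E e -> e !=set0) -> trivIset E id ->
  countable E.
Proof.
move=> dM dX cX Eo E0 tE.
pose W (n : nat) : set X := \bigcup_(v in ~` \bigcup_(e in E) e)
  [set y | d v y < n.+1%:R^-1]°.
have fin n : finite_set [set e | E e /\ e `&` ~` W n !=set0].
  apply: compact_finite_meet => //.
    apply: subclosed_compact cX _ => //; apply: open_closedC.
    by apply: bigcup_open => v _; exact: open_interior.
  move=> x nWx; apply: contrapT => Vx; apply: nWx; exists x => //.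
  by apply/dX; exists n.+1%:R^-1 => //; rewrite invr_gt0 ltr0n.
apply: (@sub_countable _ _ _ (\bigcup_n [set e | E e /\ e `&` ~` W n !=set0])).
  apply: subset_card_le => e Ee; have [p ep] := E0 e Ee.
  have /dX[eps eps0 deps] := open_nbhs_nbhs (conj (Eo e Ee) ep).
  have [n _ /(_ n (leqnn n)) neps] := near_infty_natSinv_lt (PosNum eps0).
  exists n => //; split => //; exists p; split => // -[v Vv].
  move=> /interior_subset /= dvp; apply: Vv; exists e => //; apply: deps => /=.
  by rewrite (metric_comm dM); exact: lt_trans neps.
by apply: bigcup_countable => // n _; exact: finite_set_countable.
Qed.

Lemma countable_summable {R : realType} {T : choiceType} (E : set T) :
  countable E -> exists l : T -> R, (forall e, E e -> 0 < l e) /\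
    (\esum_(e in E) (l e)%:E < +oo)%E.
Proof.
move=> /countable_injP[f finj]; exists (fun e => 1 / (2 ^ (f e).+1)%:R).
split=> [e _|]; first by rewrite divr_gt0 // ltr0n expn_gt0.
rewrite -(@esum_image _ _ _ E f (fun n => (1 / (2 ^ n.+1)%:R)%:E)) //.
apply: (@le_lt_trans _ _ (1%R : R)%:E); last exact: ltry.
apply: le_trans (epsilon_trick0 (fun n => `[< (f @` E) n >]) ler01).
rewrite nneseries_esum; last by move=> n _; rewrite lee_fin divr_ge0.
rewrite (_ : [set n | _] = f @` E) //.
by apply/seteqP; split => n /= => [/asboolP|?]; [|apply/asboolP].
Qed.

Lemma metrizable_hausdorff (R : realType) (X : topologicalType) :
  metrizable R X -> hausdorff_space X.
Proof.
move=> [d [dM dX]] x y cxy; apply: contrapT => xy.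
have dxy : 0 < d x y / 2.
  rewrite divr_gt0 // lt_neqAle; apply/andP; split.
    by apply/eqP => /esym/(metric_eq dM).
  have := metric_tri dM y x x; rewrite (metric_refl dM) (metric_comm dM y x).
  by lra.
have ball z : nbhs z [set z' | d z z' < d x y / 2].
  by apply/dX; exists (d x y / 2).
have [z [/= xz yz]] := cxy _ _ (ball x) (ball y).
by have := metric_tri dM z x y; rewrite (metric_comm dM z y); lra.
Qed.

(** Passing from edges to the arcs of [edge_param] may turn up to two points of each edge into
    vertices, so total disconnectedness has to be proved again. *)
Lemma graph_structure_exists (R : realType) (X : topologicalType) :
  continuum R X -> graph_like R X ->
  exists (E : set (set X)) (g : set X -> R -> X) (l : set X -> R),
    graph_structure E g l.
Proof.
move=> [cX conX X0 mX] [E [[Eedge tE] tdV]].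
have hX := metrizable_hausdorff mX.
have /choice[h hP] : forall e, exists h : R -> X, E e ->
    [/\ {within `[0, 1], continuous h}, {in `[0, 1] &, injective h},
        open (h @` `]0, 1[), h @` `]0, 1[ `<=` e &
        e `\` (h @` `]0, 1[) `<=` [set h 0; h 1] ].
  move=> e; have [Ee|nEe] := pselect (E e).
    by have [h hP] := edge_param hX X0 (Eedge e Ee); exists h.
  by case: X0 => x0 _; exists (cst x0).
pose arc e := h e @` `]0, 1[.
pose E' := arc @` E.
have /choice[g gP] : forall e', exists g : R -> X, E' e' ->
    [/\ {within `[0, 1], continuous g}, {in `[0, 1] &, injective g} &
        g @` `]0, 1[ = e'].
  move=> e'; have [[e Ee <-]|nEe] := pselect (E' e').
    by exists (h e) => _; have [? ? _ _ _] := hP e Ee.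
  by case: X0 => x0 _; exists (cst x0).
have E'o e' : E' e' -> open e' by move=> [e Ee <-]; have [] := hP e Ee.
have tE' : trivIset E' id.
  move=> _ _ [e1 Ee1 <-] [e2 Ee2 <-] [x [x1 x2]]; congr arc.
  have [_ _ _ s1 _] := hP e1 Ee1; have [_ _ _ s2 _] := hP e2 Ee2.
  by apply: tE => //; exists x; split; [exact: s1|exact: s2].
have E'0 e' : E' e' -> e' !=set0.
  move=> [e Ee <-]; exists (h e 2^-1); exists 2^-1 => //=.
  by rewrite in_itv /=; apply/andP; split; lra.
have [d [dM dX]] := mX.
have [l [l0 lsum]] := @countable_summable R _ _
  (countable_open_edges dM dX cX E'o E'0 tE').
exists E', g, l; split => //.
- by move=> e /gP[].
- by move=> e /gP[].
- by move=> e /gP[].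
have T1 := iffLR accessible_finite_set_closed (hausdorff_accessible hX).
move=> x V'x; apply/seteqP; split => [y|_ ->];
    last exact: connected_component_refl.
move=> [S [Sx SV' conS] Sy] /=.
(* A connected set [S] of new vertices that meets an old edge [e] meets it in at most two points.
   Such a point [p] is isolated in [S], so [S] is the singleton of [p]. Otherwise [S] consists of
   old vertices. *)
have [[p [Sp [e Ee ep]]]|SV] := pselect (S `&` \bigcup_(e in E) e !=set0).
  have [_ _ _ _ he] := hP e Ee.
  suff : [set p] = S by move=> SE; move: Sx Sy; rewrite -SE => -> ->.
  apply: conS; first by exists p.
    exists (e `&` ~` ([set h e 0; h e 1] `\ p)).
      apply: openI; first by case: (Eedge e Ee).
      apply: closed_openC; apply: T1; apply: (@sub_finite_set _ _ [set h e 0;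
          h e 1]).
        exact: subDsetl.
      exact: finite_set2.
    apply/seteqP; split => [_ ->|z [Sz [ez nz]]].
      by split => //; split => // -[_ /(_ erefl)].
    apply: contrapT => zp; apply: nz; split => //; apply: he; split => //.
    by move=> az; apply: (SV' z Sz); exists (arc e) => //; exists e.
  exists [set p]; first exact: T1.
  by apply/seteqP; split => [_ ->|z []].
have : connected_component (~` \bigcup_(e in E) e) x y.
  exists S => //; split => // z Sz Uz; apply: SV; by exists z.
rewrite tdV // => Ux; apply: SV; by exists x.
Qed.

Theorem theorem1p2 (R : realType) (X : topologicalType)
    (hX : continuum R X) (hG : graph_like R X) :
  exists d : X -> X -> R,
    [/\ is_metric d, compatible d, geodesic d & (hausdorff1 d < +oo)%E].
Proof.
have [E [g [l gsE]]] := graph_structure_exists hX hG.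
have PP := piece_system_graph gsE; have PT := piece_setT gsE.
have cX := gs_compact gsE.
exists (chain_dist (@piece R X E g l)); split.
- exact: is_metric_chain_dist PP PT.
- exact: compatible_chain_dist PP PT cX.
- exact: geodesic_chain_dist PP PT cX.
- exact: hausdorff1_chain_dist PP PT.
Qed.
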